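(* In the one-dimensional setting described in the context, assume that $\mathbf b$ is constant and that the following uniform inf-sup hypothesis holds: there is a constant $\alpha_{\mathrm{MQ}}>0$, depending only on $p$ and the coarsening structure and independent of $h$, such that \[ \sup_{v_h\in V_h\setminus\{0\}}\frac{(v_h,q_h)_{0,I}}{\|v_h\|_{0,I}}\ge\alpha_{\mathrm{MQ}}\|q_h\|_{0,I}\qquad\forall q_h\in Q_L . \] Let the stabilization parameter satisfy \[ 0\le\tau_h\le C_\tau\,c_L^{-1}\,\frac{h^2}{\max\{\varepsilon,\;h\|\mathbf b\|_{0,\infty}\}} \] for a constant $C_\tau>0$. Then there exists $\beta>0$, independent of $h$ and $\varepsilon$, such that \[ \sup_{v_h\in V_h}\frac{a_{\mathrm{MQ}}(u_h,v_h)}{\|v_h\|_{\mathrm{MQSD}}}\ge\beta\,\|u_h\|_{\mathrm{MQSD}}\qquad\forall u_h\in V_h . \]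
   Context: Let $I$ be a bounded interval, $(\cdot,\cdot)$ and $\|\cdot\|_0=\|\cdot\|_{0,I}$ the $L^2(I)$ inner product and norm, $|\cdot|_1$ the $H^1(I)$ seminorm, $\|\cdot\|_{0,\infty}$ the $L^\infty(I)$ norm. Consider $-\varepsilon u''+\mathbf b u'+cu=f$ on $I$ with homogeneous Dirichlet conditions, $\varepsilon>0$, $\mathbf b\in\mathbb R$, $c\in L^\infty(I)$, $f\in L^2(I)$, $\sigma:=c-\tfrac12\mathbf b'\ge\sigma_0>0$ a.e. (so $\sigma=c$ here). Let $a(u,v)=\varepsilon(u',v')+(\mathbf b u',v)+(cu,v)$. Let $\mathcal T_h$ be a uniform mesh of $I$ of size $h$, $\mathcal S^p(\mathcal T_h)$ the B-spline space of degree $p\ge2$ on the corresponding open knot vector (simple interior knots), and $V_h:=\mathcal S^p(\mathcal T_h)\cap H^1_0(I)$. Dyadic coarsening: $\mathcal M_h^{(0)}=\mathcal T_h$ and $\mathcal M_h^{(k)}$ ($k=1,\dots,L$) is obtained from $\mathcal M_h^{(k-1)}$ by removing every second interior knot, so its mesh size is $H^{(k)}=2^kh$; set $c_k:=h/H^{(k)}$. Let $Q_L:=\mathcal S^{p-1}(\mathcal M_h^{(L)})$ be the B-spline space of degree $p-1$ on the coarsest mesh. For each $k$, $\Pi_k^p$ is a linear quasi-interpolation projector onto the degree-$p$ B-spline space $\mathcal S^p(\mathcal M_h^{(k)})$, stable in $L^2$ ($\|\Pi_k^pv\|_0\le C_{\Pi_k^p}\|v\|_0$) and satisfying the approximation estimates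 $\|u-\Pi_k^pu\|_{H^r}\le C_{\Pi_k^p}(H^{(k)})^{s-r}\|u\|_{H^s}$, $0\le r\le s\le p+1$. With $\tau_h\ge0$ define \[ s_{\mathrm{MQ}}(u,v)=\tau_h\sum_{k=1}^Lc_k\int_I\big(\mathbf b\,(u-\Pi_k^pu)'\big)\big(\mathbf b\,(v-\Pi_k^pv)'\big)\,dx,\quad a_{\mathrm{MQ}}=a+s_{\mathrm{MQ}}, \] $\|v\|_G^2=\varepsilon|v|_1^2+\|\sigma^{1/2}v\|_0^2$, $\|v\|_{\mathrm{MQ}}^2=\|v\|_G^2+s_{\mathrm{MQ}}(v,v)$, and \[ \|v\|_{\mathrm{MQSD}}=\big(\|v\|_G^2+s_{\mathrm{MQ}}(v,v)+\tau_hc_L\|\mathbf b\,v'\|_0^2\big)^{1/2}. \] *)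

(* Defs.v *)
From HB Require Import structures.
From mathcomp Require Import all_boot all_order all_algebra.
From mathcomp Require Import all_classical all_reals all_analysis.
Set Implicit Arguments. Unset Strict Implicit. Unset Printing Implicit Defensive.
Import Order.TTheory GRing.Theory Num.Theory.
Import numFieldNormedType.Exports.
Local Open Scope classical_set_scope.
Local Open Scope ring_scope.

Section Defs.
Variable R : realType.

Local Notation mu := (@lebesgue_measure R).

Definition knot (x0 H : R) (i : nat) : R := x0 + i%:R * H.

(* Spline space S^d on the uniform mesh {x0 + i H, i = 0..M} with simple
   interior knots: piecewise polynomials of degree <= d which are C^(d-1)
   across every interior knot.  (Values outside the interval are irrelevant.) *)
Definition is_spline (d : nat) (x0 H : R) (M : nat) (f : R -> R) : Prop :=
  exists P : nat -> {poly R},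
    (forall i, (i < M)%N ->
       (size (P i) <= d.+1)%N /\
       (forall x, knot x0 H i <= x <= knot x0 H i.+1 -> f x = (P i).[x])) /\
    (forall i j, (i.+1 < M)%N -> (j < d)%N ->
       (derivn j (P i)).[knot x0 H i.+1] = (derivn j (P i.+1)).[knot x0 H i.+1]).

Definition L2ip (x0 x1 : R) (f g : R -> R) : R :=
  Rintegral mu `[x0, x1] (fun x => f x * g x).

Definition L2norm (x0 x1 : R) (f : R -> R) : R := Num.sqrt (L2ip x0 x1 f f).

Definition inL2 (x0 x1 : R) (f : R -> R) : Prop :=
  measurable_fun `[x0, x1] f /\
  (\int[mu]_(x in `[x0, x1]) ((f x) ^+ 2)%:E < +oo)%E.

Definition smooth (u : R -> R) : Prop :=
  forall (n : nat) (x : R), derivable (derive1n n u) x 1.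

(* Sobolev H^s(I) norm (for smooth functions) *)
Definition Hsnorm (x0 x1 : R) (s : nat) (u : R -> R) : R :=
  Num.sqrt (\sum_(j < s.+1) L2ip x0 x1 (derive1n j u) (derive1n j u)).

Definition Hrbroken (x0 H : R) (M r : nat) (w : R -> R) : R :=
  Num.sqrt (\sum_(j < r.+1) \sum_(e < M)
     L2ip (knot x0 H e) (knot x0 H e.+1) (derive1n j w) (derive1n j w)).

Definition nonzero_on (x0 x1 : R) (v : R -> R) : Prop :=
  exists x, x0 <= x <= x1 /\ v x != 0.

Definition msize (x0 x1 : R) (N : nat) : R := (x1 - x0) / N%:R.

Definition Vh (p : nat) (x0 x1 : R) (N : nat) (v : R -> R) : Prop :=
  is_spline p x0 (msize x0 x1 N) N v /\ v x0 = 0 /\ v x1 = 0.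

Definition Sk (d : nat) (x0 x1 : R) (N k : nat) (v : R -> R) : Prop :=
  is_spline d x0 (2 ^+ k * msize x0 x1 N) (N %/ 2 ^ k) v.

Definition QL (p : nat) (x0 x1 : R) (N L : nat) (q : R -> R) : Prop :=
  Sk p.-1 x0 x1 N L q.

Definition quasi_interp (p : nat) (x0 x1 : R) (N k : nat) (C : R)
    (Pi : (R -> R) -> (R -> R)) : Prop :=
  let H := 2 ^+ k * msize x0 x1 N in
  (forall (a : R) (f g : R -> R),
      Pi (fun x => a * f x + g x) = (fun x => a * Pi f x + Pi g x)) /\
  (forall f, Sk p x0 x1 N k (Pi f)) /\
  (forall f, Sk p x0 x1 N k f -> forall x, x0 <= x <= x1 -> Pi f x = f x) /\
  (forall f, inL2 x0 x1 f -> L2norm x0 x1 (Pi f) <= C * L2norm x0 x1 f) /\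
  (forall u, smooth u -> forall r s : nat, (r <= s <= p.+1)%N ->
      Hrbroken x0 H (N %/ 2 ^ k) r (fun x => u x - Pi u x)
        <= C * H ^+ (s - r) * Hsnorm x0 x1 s u).

(* c_k = h / H^(k) = 2^-k *)
Definition ck (k : nat) : R := (2 ^+ k)^-1.

Definition a_form (x0 x1 eps b : R) (c : R -> R) (u v : R -> R) : R :=
  eps * L2ip x0 x1 (derive1 u) (derive1 v)
  + L2ip x0 x1 (fun x => b * derive1 u x) v
  + L2ip x0 x1 (fun x => c x * u x) v.

Definition s_MQ (x0 x1 b tau : R) (L : nat) (Pi : nat -> (R -> R) -> (R -> R))
    (u v : R -> R) : R :=
  tau * \sum_(1 <= k < L.+1)
    ck k * L2ip x0 x1 (fun x => b * derive1 (fun y => u y - Pi k u y) x)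
                      (fun x => b * derive1 (fun y => v y - Pi k v y) x).

Definition a_MQ x0 x1 eps b c tau L Pi (u v : R -> R) : R :=
  a_form x0 x1 eps b c u v + s_MQ x0 x1 b tau L Pi u v.

(* ||v||_G^2 = eps |v|_1^2 + ||sigma^{1/2} v||^2, sigma = c (b constant) *)
Definition normG2 (x0 x1 eps : R) (c : R -> R) (v : R -> R) : R :=
  eps * L2ip x0 x1 (derive1 v) (derive1 v) + L2ip x0 x1 (fun x => c x * v x) v.

Definition normMQSD x0 x1 eps b c tau L Pi (v : R -> R) : R :=
  Num.sqrt (normG2 x0 x1 eps c v + s_MQ x0 x1 b tau L Pi v v
            + tau * ck L * L2ip x0 x1 (fun x => b * derive1 v x)
                                        (fun x => b * derive1 v x)).

End Defs.

(* Main.v *)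
(** Everything in sight is piecewise polynomial on the fine mesh.  Write
    E(u,v) = eps (u',v') + (c u,v) + s_MQ(u,v) for the symmetric part of a_MQ;
    since (b u',u) = 0, testing with v = u controls E(u,u) = ||u||_MQ^2, and only
    t ||b u'||^2 with t = tau c_L is missing.  Let z = Pi_L u (z = u if L = 0) and
    q = b z', an element of Q_L.  Then t ||b (u-z)'||^2 <= E(u,u), because that is
    the k = L term of s_MQ.  The inf-sup hypothesis provides w with
    (w,q) >= (alpha/2) ||q||^2 and ||w|| = ||q||, and v = u + d t w with a small
    fixed d works: the inverse estimate, the L2 stability of the Pi_k and the
    bound on tau give t ||w||_MQSD^2 <= K ||w||^2 with K independent of h, eps. *)

Require Import Defs.
From HB Require Import structures.
From mathcomp Require Import all_boot all_order all_algebra.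
From mathcomp Require Import all_classical all_reals all_analysis.
From mathcomp Require Import measurable_realfun ring lra.
Import Order.TTheory GRing.Theory Num.Theory.
Import numFieldNormedType.Exports.
Set Implicit Arguments.
Unset Strict Implicit.
Unset Printing Implicit Defensive.
Local Open Scope classical_set_scope.
Local Open Scope ring_scope.

(** * Positive semidefinite forms *)

(** The advection term is split as [b u' = b (u - z)' + q], so the correction [d t w] gains
    [d * alpha / 2] times [y = t ||q||^2]. Cauchy-Schwarz and Young charge the cross terms [E(u, w)]
    and [(b (u - z)', w)] to half of [E(u, u)] plus [d ^+ 2 * (K + 1) * y];
    [d = alpha / (4 * (K + 1))] makes that loss half of the gain. The bound on tau enters twice:
    against [eps] it cancels the [h^-2] of the inverse estimate in the diffusion term, and against
    [h |b|] it bounds [t |b| / h], whose square is what the streamline and stabilization terms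
    produce. Two obstacles shape the rest. The real [sup] is 0 on an unbounded set, so the
    conclusion also needs the quotients to be bounded; a mesh-dependent continuity constant is
    enough, since it does not enter beta. And splines are arbitrary outside the interval, so
    [derive1] is uncontrolled at the end knots: derivatives are compared on open elements only. *)

Section PsdForms.
Context {R : realType} {V : Type}.
Implicit Types (D : (V -> R) -> Prop) (B : (V -> R) -> (V -> R) -> R).

Definition lin_closed D :=
  forall (a : R) f g, D f -> D g -> D (fun x => a * f x + g x).

(** Everything is relative to a domain [D] because an integral is additive only on integrable
    arguments. Definiteness is not part of it: the stabilization vanishes on coarse splines. *)
Definition psd D B :=
  [/\ forall a f g k, D f -> D g -> D k ->
        B (fun x => a * f x + g x) k = a * B f k + B g k,
      forall f g, D f -> D g -> B f g = B g f
    & forall f, D f -> 0 <= B f f].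

Lemma psdS D D' B : (forall f, D' f -> D f) -> psd D B -> psd D' B.
Proof.
move=> DD' [lB sB pB]; split; first by move=> *; apply: lB; exact: DD'.
  by move=> *; apply: sB; exact: DD'.
by move=> *; apply: pB; exact: DD'.
Qed.

Lemma psdD D B1 B2 : psd D B1 -> psd D B2 -> psd D (fun f g => B1 f g + B2 f g).
Proof.
move=> [l1 s1 p1] [l2 s2 p2]; split.
- by move=> a f g k Df Dg Dk; rewrite l1// l2//; ring.
- by move=> f g Df Dg; rewrite s1// s2.
- by move=> f Df; rewrite addr_ge0 ?p1 ?p2.
Qed.

Lemma psdZ D B (r : R) : 0 <= r -> psd D B -> psd D (fun f g => r * B f g).
Proof.
move=> r0 [l1 s1 p1]; split.
- by move=> a f g k Df Dg Dk; rewrite l1//; ring.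
- by move=> f g Df Dg; rewrite s1.
- by move=> f Df; rewrite mulr_ge0 ?p1.
Qed.

Lemma psd_sum D (I : eqType) (s : seq I) (B : I -> (V -> R) -> (V -> R) -> R) :
  (forall i, i \in s -> psd D (B i)) ->
  psd D (fun f g => \sum_(i <- s) B i f g).
Proof.
move=> pB; split.
- move=> a f g k Df Dg Dk; rewrite mulr_sumr -big_split/= !big_seq.
  by apply: eq_bigr => i /pB[-> ].
- by move=> f g Df Dg; rewrite !big_seq; apply: eq_bigr => i /pB[_ -> ].
- by move=> f Df; rewrite big_seq; apply: sumr_ge0 => i /pB[_ _ ->].
Qed.

Section Psd.
Variables (D : (V -> R) -> Prop) (B : (V -> R) -> (V -> R) -> R).
Hypotheses (clD : lin_closed D) (psdB : psd D B).

Lemma psd_linr a f g k : D f -> D g -> D k ->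
  B k (fun x => a * f x + g x) = a * B k f + B k g.
Proof.
case: psdB => lB sB _ Df Dg Dk.
by rewrite sB ?lB ?(sB _ k)//; exact: clD.
Qed.

Lemma psd_expand a f g : D f -> D g ->
  B (fun x => a * f x + g x) (fun x => a * f x + g x) =
  a ^+ 2 * B f f + 2 * a * B f g + B g g.
Proof.
move=> Df Dg; have Dh : D (fun x => a * f x + g x) by exact: clD.
case: psdB => lB sB _.
by rewrite lB// !psd_linr// (sB g f)//; ring.
Qed.

(** The quadratic polynomial [a |-> B (a f + g) (a f + g)] is nonnegative; evaluating it at its
    minimizer gives the claim when [B f f > 0]. *)
Lemma psd_CS f g : D f -> D g -> B f g ^+ 2 <= B f f * B g g.
Proof.
case: (psdB) => _ _ pB Df Dg.
have q a : 0 <= a ^+ 2 * B f f + 2 * a * B f g + B g g.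
  by rewrite -psd_expand//; apply/pB/clD.
have := pB _ Df; rewrite le_eqVlt => /predU1P[f0|f0].
  (* When [B f f = 0] the polynomial is affine, and at this [a] it would equal -1 unless
     [B f g = 0]. *)
  have := q (- (B g g + 1) / (2 * B f g)).
  rewrite -f0 mulr0 add0r mul0r; have [->|n0] := eqVneq (B f g) 0.
    by rewrite expr0n.
  have -> : 2 * (- (B g g + 1) / (2 * B f g)) * B f g = - (B g g + 1).
    by field.
  lra.
have := q (- B f g / B f f); rewrite -(ler_pM2l f0) mulr0.
have -> : B f f * ((- B f g / B f f) ^+ 2 * B f f +
  2 * (- B f g / B f f) * B f g + B g g) = B f f * B g g - B f g ^+ 2.
  by field; rewrite gt_eqF.
lra.
Qed.

(** By the parallelogram law the two sides differ by the form at [- a f + g], which is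
    nonnegative. *)
Lemma psd_le a f g : D f -> D g ->
  B (fun x => a * f x + g x) (fun x => a * f x + g x) <=
  2 * a ^+ 2 * B f f + 2 * B g g.
Proof.
move=> Df Dg; case: (psdB) => _ _ pB.
have := pB _ (clD (- a) Df Dg); rewrite !psd_expand//; lra.
Qed.

End Psd.
End PsdForms.

(** Meant for [T u = u - Pi k u], which turns the streamline form into a summand of [s_MQ]. *)
Lemma psd_comp {R : realType} {V : Type} (D D' : (V -> R) -> Prop)
    (B : (V -> R) -> (V -> R) -> R) (T : (V -> R) -> (V -> R)) :
  psd D' B -> (forall f, D f -> D' (T f)) ->
  (forall a f g, T (fun x => a * f x + g x) = (fun x => a * T f x + T g x)) ->
  psd D (fun f g => B (T f) (T g)).
Proof.
move=> [lB sB pB] DT linT; split.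
- by move=> a f g k Df Dg Dk; rewrite linT lB//; exact: DT.
- by move=> f g Df Dg; apply: sB; exact: DT.
- by move=> f Df; apply: pB; exact: DT.
Qed.

(** * Bounded measurable functions *)

Section BoundedMeasurable.
Context {R : realType}.
Local Notation mu := (@lebesgue_measure R).
Implicit Types (f g : R -> R) (A : set R) (P Q : {poly R}).

(** A class closed under sums and products and integrable on compact intervals, so that it settles
    every integrability condition on products. *)
Definition bmeas A f :=
  measurable_fun A f /\ exists M, forall x, A x -> `|f x| <= M.

Lemma bmeas_cst A r : bmeas A (cst r).
Proof. by split; [exact: measurable_cst | exists `|r|]. Qed.

Lemma bmeasD A f g : bmeas A f -> bmeas A g -> bmeas A (fun x => f x + g x).
Proof.
move=> [mf [M fM]] [mg [N gN]]; split; first exact: measurable_funD.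
exists (M + N) => x Ax; rewrite (le_trans (ler_normD _ _))// lerD//.
  exact: fM.
exact: gN.
Qed.

Lemma bmeasM A f g : bmeas A f -> bmeas A g -> bmeas A (fun x => f x * g x).
Proof.
move=> [mf [M fM]] [mg [N gN]]; split; first exact: measurable_funM.
exists (M * N) => x Ax; rewrite normrM ler_pM//.
  exact: fM.
exact: gN.
Qed.

Lemma bmeasZ A r f : bmeas A f -> bmeas A (fun x => r * f x).
Proof. by move=> bf; apply: bmeasM => //; exact: bmeas_cst. Qed.

Lemma bmeas_lin_closed A : lin_closed (bmeas A).
Proof. by move=> a f g bf bg; apply: bmeasD => //; exact: bmeasZ. Qed.

Lemma bmeasS A B f : measurable B -> A `<=` B -> bmeas B f -> bmeas A f.
Proof.
move=> mB AB [mf [M fM]]; split; first exact: measurable_funS mf.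
by exists M => x /AB; exact: fM.
Qed.

Lemma eq_bmeas A f g : (forall x, A x -> f x = g x) -> bmeas A f -> bmeas A g.
Proof.
move=> fg [mf [M fM]]; split.
  by apply: eq_measurable_fun mf => x /set_mem; exact: fg.
by exists M => x Ax; rewrite -fg//; exact: fM.
Qed.

Lemma bmeasU A B f : measurable A -> measurable B ->
  bmeas A f -> bmeas B f -> bmeas (A `|` B) f.
Proof.
move=> mA mB [mf [M fM]] [mg [N gN]]; split; first exact/measurable_funU.
exists (Num.max M N) => x [Ax|Bx]; rewrite le_max.
  by rewrite fM.
by rewrite gN ?orbT.
Qed.

Lemma bmeas_set1 a f : bmeas [set a] f.
Proof.
by split; [exact: measurable_fun_set1 | exists `|f a| => x ->].
Qed.

Lemma bmeas_horner P (a b : R) : bmeas `]a, b[ (horner P).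
Proof.
apply: (@bmeasS _ `[a, b]) => //; first exact: subset_itv_oo_cc.
split.
  apply: (@measurable_funS _ _ _ _ setT) => //.
  by apply: continuous_measurable_fun; exact: continuous_horner.
have : compact (horner P @` `[a, b]).
  apply: continuous_compact; last exact: segment_compact.
  by apply: continuous_subspaceT; exact: continuous_horner.
move=> /compact_bounded[M [_ PM]]; exists (M + 1) => x abx.
by apply: (PM (M + 1)); [rewrite ltrDl | exists x].
Qed.

Lemma bmeas_integrable (a b : R) f : bmeas `[a, b] f ->
  mu.-integrable `[a, b] (EFin \o f).
Proof.
move=> [mf [M fM]]; apply: measurable_bounded_integrable => //=.
  by rewrite lebesgue_measure_itv/=; case: ifPn => // _; rewrite -EFinD ltry.
exists M; split; first exact: num_real.
by move=> N MN x abx; apply: le_trans (fM _ abx) _; exact: ltW.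
Qed.

Lemma Rintegral_itv_cc_oo (a b : R) f : bmeas `[a, b] f ->
  \int[mu]_(x in `[a, b]) f x = \int[mu]_(x in `]a, b[) f x.
Proof.
move=> [mf _]; rewrite /Rintegral (integral_itv_bndoo true false)//.
apply/measurable_EFinP; apply: measurable_funS mf => //.
exact: subset_itv_oo_cc.
Qed.

(** * Integrals of polynomials and the weighted L2 form *)

Lemma antideriv_exists P : exists A : {poly R}, A^`() = P.
Proof.
exists (\poly_(i < (size P).+1) (P`_i.-1 / i%:R)).
apply/polyP => i; rewrite coef_deriv coef_poly ltnS.
have [iP|iP] := ltnP i (size P).
  by rewrite -mulrnAl -mulr_natr mulfK// pnatr_eq0.
by rewrite mul0rn nth_default.
Qed.

Lemma Rintegral_deriv_poly P (a b : R) : a < b ->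
  \int[mu]_(x in `[a, b]) P^`().[x] = P.[b] - P.[a].
Proof.
move=> ab; rewrite /Rintegral (@continuous_FTC2 _ (horner P^`()) (horner P))//.
- by apply: continuous_subspaceT; exact: continuous_horner.
- split; first by move=> x _; exact: derivable_horner.
    exact/cvg_at_right_filter/continuous_horner.
  exact/cvg_at_left_filter/continuous_horner.
- by move=> x _; rewrite -derivE.
Qed.

Lemma L2ip_psd (a b : R) w : bmeas `[a, b] w ->
  (forall x, `[a, b]%classic x -> 0 <= w x) ->
  psd (bmeas `[a, b]) (fun f g => L2ip a b (fun x => w x * f x) g).
Proof.
move=> bw w0; split.
- move=> r f g k bf bg bk; rewrite /L2ip -RintegralZl//; last first.
    by apply: bmeas_integrable; apply: bmeasM => //; exact: bmeasM.
  rewrite -RintegralD//.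
  + by apply: eq_Rintegral => x _; ring.
  + by apply: bmeas_integrable; apply: bmeasZ; apply: bmeasM => //; exact: bmeasM.
  + by apply: bmeas_integrable; apply: bmeasM => //; exact: bmeasM.
- by move=> f g bf bg; apply: eq_Rintegral => x _; ring.
- move=> f bf; apply: Rintegral_ge0 => x abx.
  by rewrite -mulrA -expr2 mulr_ge0 ?sqr_ge0//; exact: w0.
Qed.

Lemma L2ip1 (a b : R) f g : L2ip a b (fun x => cst 1 x * f x) g = L2ip a b f g.
Proof. by apply: eq_Rintegral => x _; rewrite /cst mul1r. Qed.

Lemma L2ip_psd1 (a b : R) : psd (bmeas `[a, b]) (L2ip a b).
Proof.
have := @L2ip_psd a b (cst 1) (bmeas_cst _ _) (fun _ _ => ler01).
have -> : (fun f g => L2ip a b (fun x => cst 1 x * f x) g) = L2ip a b => //.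
by apply/funext => f; apply/funext => g; exact: L2ip1.
Qed.

Lemma L2ipZZ (a b r : R) f g : bmeas `[a, b] f -> bmeas `[a, b] g ->
  L2ip a b (fun x => r * f x) (fun x => r * g x) = r ^+ 2 * L2ip a b f g.
Proof.
move=> bf bg; rewrite /L2ip -RintegralZl//; last exact/bmeas_integrable/bmeasM.
by apply: eq_Rintegral => x _; ring.
Qed.

Lemma ler_L2ip_weight (a b K : R) w f : bmeas `[a, b] w -> bmeas `[a, b] f ->
  (forall x, `[a, b]%classic x -> w x <= K) ->
  L2ip a b (fun x => w x * f x) f <= K * L2ip a b f f.
Proof.
move=> bw bf wK; rewrite /L2ip -RintegralZl//; last exact/bmeas_integrable/bmeasM.
apply: le_Rintegral => //.
- by apply: bmeas_integrable; apply: bmeasM => //; exact: bmeasM.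
- by apply: bmeas_integrable; apply: bmeasZ; exact: bmeasM.
- by move=> x abx; rewrite -mulrA ler_wpM2r ?wK// -expr2 sqr_ge0.
Qed.

Lemma ger_L2ip_weight (a b k : R) w f : bmeas `[a, b] w -> bmeas `[a, b] f ->
  (forall x, `[a, b]%classic x -> k <= w x) ->
  k * L2ip a b f f <= L2ip a b (fun x => w x * f x) f.
Proof.
move=> bw bf wK; rewrite /L2ip -RintegralZl//; last exact/bmeas_integrable/bmeasM.
apply: le_Rintegral => //.
- by apply: bmeas_integrable; apply: bmeasZ; exact: bmeasM.
- by apply: bmeas_integrable; apply: bmeasM => //; exact: bmeasM.
- by move=> x abx; rewrite -mulrA ler_wpM2r ?wK// -expr2 sqr_ge0.
Qed.

Lemma sqr_L2norm (a b : R) f : L2norm a b f ^+ 2 = L2ip a b f f.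
Proof.
rewrite sqr_sqrtr//; apply: Rintegral_ge0 => x _.
by rewrite -expr2 sqr_ge0.
Qed.

Lemma bmeas_inL2 (a b : R) f : bmeas `[a, b] f -> inL2 a b f.
Proof.
move=> bf; split; first by case: bf.
exact/integrable_lty/(bmeas_integrable (bmeasM bf bf)).
Qed.

End BoundedMeasurable.

(** * Inverse estimate for polynomials *)

Section InverseEstimate.
Context {R : realType}.
Local Notation mu := (@lebesgue_measure R).
Implicit Types (P Q : {poly R}).

(** Induction with [(b + S)^2 <= 2 b^2 + 2 S^2], hence the power of 2; only dependence on [n] alone
    matters. *)
Lemma sqr_sum_le (n : nat) (a : 'I_n -> R) :
  (\sum_i a i) ^+ 2 <= 2 ^+ n * \sum_i a i ^+ 2.
Proof.
elim: n a => [|n IH] a; first by rewrite !big_ord0 expr0n mulr0.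
rewrite !big_ord_recl [2 ^+ n.+1]exprS.
have := IH (fun i => a (lift ord0 i)).
set S := \sum_(i < n) _; set T := \sum_(i < n) _; set b := a ord0.
have n1 : 1 <= 2 ^+ n :> R by rewrite exprn_ege1// ler1n.
have : b ^+ 2 <= 2 ^+ n * b ^+ 2 by rewrite ler_peMl ?sqr_ge0.
have := sqr_ge0 (b - S).
have -> : 2 * 2 ^+ n * (b ^+ 2 + T) = 2 * (2 ^+ n * b ^+ 2) + 2 * (2 ^+ n * T).
  by ring.
move: (2 ^+ n * b ^+ 2) (2 ^+ n * T) => y z; nra.
Qed.

Lemma bmeas_horner_cc P (a b : R) : bmeas `[a, b] (horner P).
Proof.
apply: (@bmeasS _ _ `]a - 1, b + 1[) => //; last exact: bmeas_horner.
move=> x /=; rewrite !in_itv/= => /andP[ax xb]; apply/andP; lra.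
Qed.

Local Notation ip P Q := (L2ip 0 1 (horner P) (horner Q)).

Lemma ip_linear (a : R) P1 P2 Q : ip (a *: P1 + P2) Q = a * ip P1 Q + ip P2 Q.
Proof.
have [l _ _] := @L2ip_psd1 R 0 1.
rewrite -l; [|exact: bmeas_horner_cc..].
by apply: eq_Rintegral => x _; rewrite hornerD hornerZ.
Qed.

Lemma ip_sum n (c : 'I_n -> R) (P : 'I_n -> {poly R}) Q :
  ip (\sum_i c i *: P i) Q = \sum_i c i * ip (P i) Q.
Proof.
elim: n c P => [|n IH] c P.
  rewrite !big_ord0 /L2ip (@eq_Rintegral _ _ _ _ _ (cst 0)); last first.
    by move=> x _; rewrite horner0 mul0r.
  by rewrite Rintegral_cst// mul0r.
by rewrite !big_ord_recl ip_linear IH.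
Qed.

Lemma ip_sym P Q : ip P Q = ip Q P.
Proof. by apply: eq_Rintegral => x _; rewrite mulrC. Qed.

Lemma ip_ge0 P : 0 <= ip P P.
Proof. by rewrite -sqr_L2norm sqr_ge0. Qed.

(** An antiderivative [A] of [P * P] is nondecreasing with equal values at 0 and 1, so it is
    constant on the unit interval, hence constant as a polynomial. *)
Lemma ip_definite P : ip P P = 0 -> P = 0.
Proof.
move=> P0; have [A A'] := antideriv_exists (P * P).
have inc (a b : R) : a < b -> A.[a] <= A.[b].
  move=> ab; rewrite -subr_ge0 -(Rintegral_deriv_poly A ab) A'.
  by apply: Rintegral_ge0 => x _; rewrite hornerM -expr2 sqr_ge0.
have A01 : A.[1] = A.[0].
  apply: subr0_eq; rewrite -[RHS]P0 -(Rintegral_deriv_poly A ltr01) A'.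
  by apply: eq_Rintegral => x _; rewrite hornerM.
have : A - (A.[0])%:P = 0.
  apply/eqP/negP => /negP nz.
  (* As many distinct points of the open unit interval as the size of the polynomial: too many roots
     for a nonzero one. *)
  pose rs := [seq (i.+2%:R : R)^-1 | i <- iota 0 (size (A - (A.[0])%:P))].
  have : (size rs < size (A - (A.[0])%:P)%R)%N.
    apply: max_poly_roots => //.
      apply/allP => x /mapP[i _ ->]; rewrite rootE !hornerE subr_eq0 eq_le.
      have i0 : 0 < (i.+2%:R : R)^-1 by rewrite invr_gt0.
      have i1 : (i.+2%:R : R)^-1 < 1 by rewrite invf_lt1// ltr1n.
      by rewrite -{1}A01 !inc.
    rewrite map_inj_uniq ?iota_uniq// => i j /invr_inj/eqP.
    by rewrite eqr_nat => /eqP[].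
  by rewrite size_map size_iota ltnn.
move/eqP; rewrite subr_eq0 => /eqP AE.
by move: A'; rewrite AE derivC => /esym/eqP; rewrite mulf_eq0 orbb => /eqP.
Qed.

(* The Gram matrix of the monomials on [0, 1] is invertible, so the
   coefficients of Q are controlled by its moments and hence by its L2 norm. *)
Lemma inverse_estimate_ref n : exists2 C : R, 0 <= C &
  forall Q, (size Q <= n)%N -> ip Q^`() Q^`() <= C * ip Q Q.
Proof.
pose G := \matrix_(i < n, j < n) ip 'X^i 'X^j : 'M[R]_n.
have momE (v : 'rV[R]_n) j : (v *m G) 0 j = ip (\sum_i v 0 i *: 'X^i) 'X^j.
  by rewrite ip_sum mxE; apply: eq_bigr => i _; rewrite mxE.
have Gu : G \in unitmx.
  (* A vector in the left kernel of [G] is the coefficient vector of a [Q] orthogonal to all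
     monomials ['X^j] with [j < n], hence to itself. *)
  rewrite -row_free_unit -kermx_eq0; apply/eqP/row_matrixP => k; rewrite row0.
  set v := row k _.
  have vG : v *m G = 0 by apply/sub_kermxP; exact: row_sub.
  pose Q := \sum_(i < n) v 0 i *: 'X^i : {poly R}.
  have /ip_definite Q0 : ip Q Q = 0.
    rewrite {1}/Q ip_sum big1// => i _.
    by rewrite ip_sym -momE vG [X in _ * X]mxE mulr0.
  apply/rowP => i; rewrite [RHS]mxE; have := congr1 (fun P : {poly R} => P`_i) Q0.
  rewrite coef_sum coef0 (bigD1 i)//= coefZ coefXn eqxx mulr1 big1 ?addr0// => j ji.
  by rewrite coefZ coefXn eq_sym val_eqE (negbTE ji) mulr0.
pose D (i : 'I_n) := 2 ^+ n * \sum_(j < n) ip 'X^j 'X^j * invmx G j i ^+ 2.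
have D0 i : 0 <= D i.
  rewrite mulr_ge0 ?exprn_ge0//; apply: sumr_ge0 => j _.
  by rewrite mulr_ge0 ?sqr_ge0// ip_ge0.
exists (2 ^+ n * \sum_(i < n) D i * ip ('X^i)^`() ('X^i)^`()).
  rewrite mulr_ge0 ?exprn_ge0//; apply: sumr_ge0 => i _.
  by rewrite mulr_ge0// ip_ge0.
move=> Q Qn.
have QE : Q = \sum_(i < n) Q`_i *: 'X^i.
  by rewrite -poly_def; apply/polyP => i; rewrite coef_poly; case: ltnP => // ni;
    rewrite nth_default// (leq_trans Qn).
have coefQ (i : 'I_n) : Q`_i ^+ 2 <= D i * ip Q Q.
  pose v := \row_(i < n) Q`_i.
  have -> : Q`_i = (v *m G *m invmx G) 0 i by rewrite mulmxK// mxE.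
  rewrite mxE (le_trans (sqr_sum_le _))// -mulrA ler_wpM2l ?exprn_ge0// mulr_suml.
  apply: ler_sum => j _; rewrite exprMn [leRHS]mulrAC ler_wpM2r ?sqr_ge0//.
  rewrite momE (eq_bigr (fun i : 'I_n => Q`_i *: 'X^i)); last first.
    by move=> l _; rewrite mxE.
  rewrite -QE mulrC.
  exact: (psd_CS (@bmeas_lin_closed _ `[0, 1]) (@L2ip_psd1 _ 0 1)
    (bmeas_horner_cc Q 0 1) (bmeas_horner_cc 'X^j 0 1)).
have Q'E : Q^`() = \sum_(i < n) Q`_i *: ('X^i)^`().
  by rewrite {1}QE raddf_sum; apply: eq_bigr => i _; exact: derivZ.
apply: (@le_trans _ _ (2 ^+ n * \sum_(i < n) Q`_i ^+ 2 * ip ('X^i)^`() ('X^i)^`())).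
  have ipE : \sum_(i < n) Q`_i ^+ 2 * ip ('X^i)^`() ('X^i)^`() =
      \int[mu]_(x in `[0, 1]) (\sum_(i < n) (Q`_i *: ('X^i)^`() * (Q`_i *: ('X^i)^`()))).[x].
    transitivity (ip (\sum_(i < n) Q`_i ^+ 2 *: (('X^i)^`() * ('X^i)^`())) 1).
      rewrite ip_sum; apply: eq_bigr => i _; congr (_ * _).
      by apply: eq_Rintegral => x _; rewrite !hornerE.
    apply: eq_Rintegral => x _; rewrite hornerC mulr1; congr (_.[x]).
    by apply: eq_bigr => i _; rewrite -scalerAl -scalerAr scalerA -expr2.
  rewrite ipE -RintegralZl//; last exact/bmeas_integrable/bmeas_horner_cc.
  apply: le_Rintegral => //.
  - by apply: bmeas_integrable; apply: bmeasM; exact: bmeas_horner_cc.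
  - by apply: bmeas_integrable; apply: bmeasZ; exact: bmeas_horner_cc.
  move=> x _; rewrite Q'E -expr2 !horner_sum.
  apply: le_trans (sqr_sum_le _) _.
  by rewrite ler_wpM2l ?exprn_ge0//; apply: ler_sum => i _; rewrite hornerM expr2.
rewrite -mulrA ler_wpM2l ?exprn_ge0// mulr_suml; apply: ler_sum => i _.
by rewrite [leRHS]mulrAC ler_wpM2r ?ip_ge0.
Qed.

(** The fundamental theorem is applied to an antiderivative before and after composition with the
    affine map, so the change of variables becomes the chain rule for polynomials. *)
Lemma Rintegral_affine P (a h : R) : 0 < h ->
  \int[mu]_(x in `[a, a + h]) P.[x] =
  h * \int[mu]_(x in `[0, 1]) (P \Po (h *: 'X + a%:P)).[x].
Proof.
move=> h0; have [A <-] := antideriv_exists P.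
rewrite Rintegral_deriv_poly; last by rewrite ltrDl.
rewrite -RintegralZl//; last exact/bmeas_integrable/bmeas_horner_cc.
transitivity (\int[mu]_(x in `[0, 1]) ((A \Po (h *: 'X + a%:P))^`()).[x]).
  rewrite Rintegral_deriv_poly//.
  by rewrite !horner_comp !hornerE [h + a]addrC.
apply: eq_Rintegral => x _.
by rewrite deriv_comp derivD derivZ derivX derivC addr0 alg_polyC hornerM hornerC mulrC.
Qed.

(** Scaling to the unit interval: the derivative of the composed polynomial carries a factor [h],
    and its square moves to the other side. *)
Lemma inverse_estimate n : exists2 C : R, 0 <= C &
  forall (a h : R) P, 0 < h -> (size P <= n)%N ->
  L2ip a (a + h) (horner P^`()) (horner P^`()) <=
  C / h ^+ 2 * L2ip a (a + h) (horner P) (horner P).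
Proof.
have [C C0 invC] := inverse_estimate_ref n.
exists C => // a h P h0 Pn; pose Q := P \Po (h *: 'X + a%:P).
have ipE (S : {poly R}) : L2ip a (a + h) (horner S) (horner S) =
    h * ip (S \Po (h *: 'X + a%:P)) (S \Po (h *: 'X + a%:P)).
  transitivity (\int[mu]_(x in `[a, a + h]) (S * S).[x]).
    by apply: eq_Rintegral => x _; rewrite hornerM.
  rewrite Rintegral_affine//; congr (_ * _); apply: eq_Rintegral => x _.
  by rewrite comp_polyM hornerM.
have Q' : Q^`() = h *: (P^`() \Po (h *: 'X + a%:P)).
  by rewrite deriv_comp derivD derivZ derivX derivC addr0 alg_polyC mulrC mul_polyC.
have Qn : (size Q <= n)%N.
  rewrite size_comp_poly2// size_polyDl size_scale ?gt_eqF// size_polyX//.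
  exact: leq_ltn_trans (size_polyC_leq1 _) _.
have ipZ S : ip (h *: S) (h *: S) = h ^+ 2 * ip S S.
  rewrite -L2ipZZ; [|exact: bmeas_horner_cc..].
  by apply: eq_Rintegral => x _; rewrite !hornerZ.
have := invC _ Qn; rewrite Q' ipZ !ipE -/Q => QC.
by rewrite mulrCA ler_pM2l// [leRHS]mulrAC ler_pdivlMr ?exprn_gt0// mulrC.
Qed.
End InverseEstimate.

(** * Piecewise polynomials and splines *)

Section PiecewisePolynomials.
Context {R : realType}.
Local Notation mu := (@lebesgue_measure R).
Variables (x0 x1 h : R) (N : nat).
Hypotheses (h0 : 0 < h) (x1E : knot x0 h N = x1).
Implicit Types (f g : R -> R).
Local Notation k := (knot x0 h).
Local Notation I := `[x0, x1]%classic.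

Lemma knot0 : k 0 = x0. Proof. by rewrite /knot mul0r addr0. Qed.

Lemma knot_lt i j : (i < j)%N -> k i < k j.
Proof. by move=> ij; rewrite ltrD2l ltr_pM2r// ltr_nat. Qed.

Lemma knot_le i j : (i <= j)%N -> k i <= k j.
Proof. by move=> ij; rewrite lerD2l ler_pM2r// ler_nat. Qed.

Lemma knotS i : k i.+1 = k i + h.
Proof. by rewrite /knot -natr1 mulrDl mul1r addrA. Qed.

Lemma subset_elt i : (i < N)%N -> `[k i, k i.+1] `<=` I.
Proof.
move=> iN x /=; rewrite !in_itv/= => /andP[ix xi].
have := knot_le (leq0n i); rewrite knot0 => /le_trans -> //=.
by rewrite (le_trans xi)// -x1E knot_le.
Qed.

(** The knots, a null set, are left out because [derive1] is not determined by the pieces there. *)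
Definition eq_elts f g :=
  forall i x, (i < N)%N -> k i < x < k i.+1 -> f x = g x.

Definition pieces d f (P : nat -> {poly R}) := forall i, (i < N)%N ->
  (size (P i) <= d.+1)%N /\ forall x, k i < x < k i.+1 -> f x = (P i).[x].

(** No continuity at the knots is asked and the degree bound is kept under differentiation, so one
    class contains splines of every level, their differences and their derivatives. *)
Definition pp d f := exists P, pieces d f P.

Lemma pp_lin_closed d : lin_closed (pp d).
Proof.
move=> a f g [P fP] [Q gQ]; exists (fun i => a *: P i + Q i) => i iN.
have [sP {}fP] := fP _ iN; have [sQ {}gQ] := gQ _ iN; split.
  rewrite (leq_trans (size_polyD _ _))// geq_max sQ andbT.
  exact: leq_trans (size_scale_leq _ _) sP.
by move=> x xi; rewrite fP// gQ// hornerD hornerZ.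
Qed.

Lemma pp_sub d f g : pp d f -> pp d g -> pp d (fun x => f x - g x).
Proof.
move=> pf pg; rewrite (_ : (fun _ => _) = (fun x => -1 * g x + f x)).
  exact: pp_lin_closed.
by apply/funext => x; rewrite mulN1r addrC.
Qed.

Lemma pp_bmeas d f : pp d f -> bmeas I f.
Proof.
move=> [P fP]; rewrite -x1E.
suff: forall n, (n <= N)%N -> bmeas `[x0, k n] f by exact.
elim=> [_|n IH nN]; first by rewrite knot0 set_itv1; exact: bmeas_set1.
have kn : k n < k n.+1 by exact: knot_lt.
have x0n : x0 <= k n by rewrite -{1}knot0 knot_le.
have -> : `[x0, k n.+1]%classic =
    `[x0, k n] `|` (`]k n, k n.+1[ `|` [set k n.+1]).
  apply/seteqP; split=> x /=; rewrite !in_itv/=.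
    move=> /andP[-> xn]; have [|nx] := leP x (k n); first by left.
    right; move: xn; rewrite le_eqVlt => /predU1P[->|xn]; first by right.
    by left.
  move=> [|[|->]]; rewrite ?in_itv/=; last by rewrite lexx andbT; lra.
    by move=> /andP[-> ?]/=; lra.
  by move=> /andP[? ?]; apply/andP; lra.
apply: bmeasU => //; [exact: measurableU|exact/IH/ltnW|].
apply: bmeasU => //; last exact: bmeas_set1.
have [_ fPn] := fP _ nN.
apply: eq_bmeas (bmeas_horner (P n) (k n) (k n.+1)) => x.
by rewrite /= in_itv/= => /fPn.
Qed.

Lemma Rintegral_elts f : bmeas I f ->
  \int[mu]_(x in I) f x = \sum_(i < N) \int[mu]_(x in `[k i, k i.+1]) f x.
Proof.
rewrite -x1E => bf.
suff: forall n, (n <= N)%N -> \int[mu]_(x in `[x0, k n]) f x =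
  \sum_(i < n) \int[mu]_(x in `[k i, k i.+1]) f x by exact.
elim=> [_|n IH nN]; first by rewrite big_ord0 knot0 set_itv1 Rintegral_set1.
have kn : k n < k n.+1 by exact: knot_lt.
have x0n : x0 <= k n by rewrite -{1}knot0 knot_le.
have knN : k n.+1 <= k N by exact: knot_le.
have bfn : bmeas `[x0, k n.+1] f.
  by apply: bmeasS bf => //; apply: subset_itvl; rewrite bnd_simp.
have bn : bmeas `[k n, k n.+1] f.
  by apply: bmeasS bfn => //; apply: subset_itvr; rewrite bnd_simp.
rewrite big_ord_recr/= -IH 1?ltnW//; apply: (addrI (- \int[mu]_(x in `[x0, k n]) f x)).
rewrite addKr addrC Rintegral_itvB ?bnd_simp//;
  [|exact: bmeas_integrable|exact: ltW].
rewrite Rintegral_itv_obnd_cbnd//.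
apply: integrableS (bmeas_integrable bn) => //.
exact: subset_itv_oc_cc.
Qed.

Lemma eq_elts_L2ip f f' g g' : bmeas I f -> bmeas I f' -> bmeas I g ->
  bmeas I g' -> eq_elts f f' -> eq_elts g g' -> L2ip x0 x1 f g = L2ip x0 x1 f' g'.
Proof.
move=> bf bf' bg bg' ff' gg'; rewrite /L2ip !Rintegral_elts; [|exact: bmeasM..].
apply: eq_bigr => i _.
have sub := subset_elt (ltn_ord i).
rewrite !Rintegral_itv_cc_oo; try by apply: bmeasS sub _ => //; exact: bmeasM.
apply: eq_Rintegral => x /set_mem/=; rewrite in_itv/= => xi.
by rewrite (ff' i)// (gg' i).
Qed.

Lemma pieces_derive1 d f P i x : pieces d f P -> (i < N)%N ->
  k i < x < k i.+1 -> derive1 f x = (P i)^`().[x].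
Proof.
move=> fP iN xi; have [_ {}fP] := fP _ iN.
have near_fP : \near x, f x = (P i).[x].
  have : x \in `]k i, k i.+1[ by rewrite in_itv.
  move=> /near_in_itvoo; apply: filterS => y; rewrite in_itv/=; exact: fP.
by rewrite derivE !derive1E; exact: near_eq_derive.
Qed.

Lemma pp_derive1 d f : pp d f -> pp d (derive1 f).
Proof.
move=> [P fP]; exists (fun i => (P i)^`()) => i iN; split; last first.
  by move=> x xi; exact: (pieces_derive1 fP iN xi).
have [sP _] := fP _ iN.
have [->|nz] := eqVneq (P i) 0; first by rewrite deriv0 size_poly0.
exact: leq_trans (ltnW (lt_size_deriv nz)) sP.
Qed.

Lemma derive1_lin d a f g : pp d f -> pp d g ->
  eq_elts (derive1 (fun x => a * f x + g x))
          (fun x => a * derive1 f x + derive1 g x).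
Proof.
move=> [P fP] [Q gQ] i x iN xi.
rewrite (pieces_derive1 fP iN xi) (pieces_derive1 gQ iN xi).
have fgPQ : pieces d (fun x => a * f x + g x) (fun i => a *: P i + Q i).
  move=> j jN; have [sP {}fP] := fP _ jN; have [sQ {}gQ] := gQ _ jN; split.
    rewrite (leq_trans (size_polyD _ _))// geq_max sQ andbT.
    exact: leq_trans (size_scale_leq _ _) sP.
  by move=> y yj; rewrite fP// gQ// hornerD hornerZ.
by rewrite (pieces_derive1 fgPQ iN xi) derivD derivZ hornerD hornerZ.
Qed.

(** [derive1] is known to be linear only inside the elements, so linearity of the form is obtained
    through [eq_elts_L2ip]. *)
Lemma L2ip_derive1_psd d b : psd (pp d)
  (fun f g => L2ip x0 x1 (fun x => b * derive1 f x) (fun x => b * derive1 g x)).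
Proof.
have [l s p] := @L2ip_psd1 R x0 x1.
have bd f : pp d f -> bmeas I (fun x => b * derive1 f x).
  by move=> /pp_derive1/pp_bmeas; exact: bmeasZ.
split=> [a f g q pf pg pq|f g pf pg|f pf]; [|by apply: s; exact: bd|by apply: p; exact: bd].
rewrite -l; [|exact: bd..].
apply: eq_elts_L2ip => //; [by apply: bd; exact: pp_lin_closed| |exact: bd|exact: bd|].
  by apply: bmeas_lin_closed; exact: bd.
by move=> i x iN xi; rewrite (derive1_lin a pf pg iN xi); ring.
Qed.

(** The polynomial estimate is a hypothesis so that [C] can be fixed once, before any mesh is
    chosen. *)
Lemma ler_derive1_L2ip d C f : pp d f ->
  (forall a h (P : {poly R}), 0 < h -> (size P <= d.+1)%N ->
    L2ip a (a + h) (horner P^`()) (horner P^`()) <=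
    C / h ^+ 2 * L2ip a (a + h) (horner P) (horner P)) ->
  L2ip x0 x1 (derive1 f) (derive1 f) <= C / h ^+ 2 * L2ip x0 x1 f f.
Proof.
move=> pf inv; have [P fP] := pf; have bf := pp_bmeas pf.
have bf' := pp_bmeas (pp_derive1 pf).
rewrite /L2ip !Rintegral_elts; [|exact: bmeasM..].
rewrite mulr_sumr; apply: ler_sum => i _.
have [sP fPi] := fP _ (ltn_ord i).
have := inv (k i) h (P i) h0 sP; rewrite -knotS.
have sub := subset_elt (ltn_ord i).
have eqi g (Q : {poly R}) : bmeas I g -> (forall x, k i < x < k i.+1 -> g x = Q.[x]) ->
    L2ip (k i) (k i.+1) (horner Q) (horner Q) = \int[mu]_(x in `[k i, k i.+1]) (g x * g x).
  move=> bg gQ; rewrite /L2ip !Rintegral_itv_cc_oo.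
  - by apply: eq_Rintegral => x /set_mem/=; rewrite in_itv/= => xi; rewrite gQ.
  - by apply: bmeasS sub _ => //; exact: bmeasM.
  - by apply: bmeasM; exact: bmeas_horner_cc.
rewrite (eqi f (P i))// (eqi (derive1 f) (P i)^`())// => x xi.
exact: (pieces_derive1 fP (ltn_ord i) xi).
Qed.

Lemma coarse_elt m i : (2 ^ m %| N)%N -> (i < N)%N ->
  [/\ (i %/ 2 ^ m < N %/ 2 ^ m)%N, knot x0 (2 ^+ m * h) (i %/ 2 ^ m) <= k i
    & k i.+1 <= knot x0 (2 ^+ m * h) (i %/ 2 ^ m).+1].
Proof.
move=> mN iN; have m0 : (0 < 2 ^ m)%N by rewrite expn_gt0.
have knotE j : knot x0 (2 ^+ m * h) j = k (j * 2 ^ m)%N.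
  by rewrite /knot natrM natrX mulrA.
by split; rewrite ?knotE ?knot_le ?leq_trunc_div ?ltn_ceil// ltn_divLR// divnK.
Qed.

(** The dyadic meshes are nested: a fine element inherits the polynomial of the coarse element that
    contains it. The case [m = 0] covers the fine splines. *)
Lemma spline_pp d m f : (2 ^ m %| N)%N ->
  is_spline d x0 (2 ^+ m * h) (N %/ 2 ^ m) f -> pp d f.
Proof.
move=> mN [P [fP _]]; exists (fun i => P (i %/ 2 ^ m)%N) => i iN.
have [jN ji ij] := coarse_elt mN iN.
have [sP {}fP] := fP _ jN; split=> // x /andP[ix xi]; apply: fP.
by rewrite (le_trans ji (ltW ix)) (le_trans (ltW xi) ij).
Qed.

(** On each element [f f'] is the derivative of [f^2 / 2]. The sum telescopes because [is_spline]
    prescribes [f] on closed elements, so neighbouring pieces share the value at the knot. *)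
Lemma spline_integration_by_parts d f : is_spline d x0 h N f ->
  L2ip x0 x1 (derive1 f) f = (f x1 ^+ 2 - f x0 ^+ 2) / 2.
Proof.
move=> sf; have pf : pp d f.
  by apply: (@spline_pp _ 0) => //; rewrite expr0 mul1r expn0 divn1.
have [P [fP _]] := sf.
have fP' : pieces d f P.
  move=> i iN; have [sP {}fP] := fP _ iN; split=> // x /andP[ix xi].
  by apply: fP; rewrite !ltW.
have bf := pp_bmeas pf; have bf' := pp_bmeas (pp_derive1 pf).
rewrite /L2ip Rintegral_elts; last exact: bmeasM.
transitivity (\sum_(i < N) (f (k i.+1) ^+ 2 / 2 - f (k i) ^+ 2 / 2)).
  apply: eq_bigr => i _; have [_ {}fP] := fP _ (ltn_ord i).
  have sub := subset_elt (ltn_ord i).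
  have ki := knot_lt (ltnSn i).
  rewrite !fP ?lexx ?ltW//.
  transitivity (\int[mu]_(x in `[k i, k i.+1]) (2^-1 *: (P i * P i))^`().[x]).
    rewrite !Rintegral_itv_cc_oo; [|exact: bmeas_horner_cc|]; last first.
      by apply: bmeasS sub _ => //; exact: bmeasM.
    apply: eq_Rintegral => x /set_mem/=; rewrite in_itv/= => xi.
    rewrite (pieces_derive1 fP' _ xi)// fP; last by case/andP: xi => *; rewrite !ltW.
    by rewrite derivZ derivM !hornerE; field.
  by rewrite Rintegral_deriv_poly// !hornerZ !hornerM; field.
rewrite -(big_mkord xpredT (fun i => f (k i.+1) ^+ 2 / 2 - f (k i) ^+ 2 / 2)).
by rewrite telescope_sumr// x1E knot0 -mulrBl.
Qed.

End PiecewisePolynomials.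

(** * Gluing pieces and differentiating splines *)

Section Splines.
Context {R : realType}.
Implicit Types (f g : R -> R).

Lemma spline_lin_closed d (x0 H : R) M : lin_closed (is_spline d x0 H M).
Proof.
move=> a f g [P [fP cP]] [Q [gQ cQ]]; exists (fun i => a *: P i + Q i); split.
  move=> i iN; have [sP {}fP] := fP _ iN; have [sQ {}gQ] := gQ _ iN; split.
    rewrite (leq_trans (size_polyD _ _))// geq_max sQ andbT.
    exact: leq_trans (size_scale_leq _ _) sP.
  by move=> x xi; rewrite fP// gQ// hornerD hornerZ.
by move=> i j iM jd; rewrite !derivnD !derivnZ !hornerD !hornerZ cP// cQ.
Qed.

Lemma glue_pieces (x0 H : R) M (P : nat -> {poly R}) : 0 < H ->
  (forall i, (i.+1 < M)%N -> (P i).[knot x0 H i.+1] = (P i.+1).[knot x0 H i.+1]) ->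
  exists q, forall i, (i < M)%N -> forall x,
    knot x0 H i <= x <= knot x0 H i.+1 -> q x = (P i).[x].
Proof.
move=> H0; case: M => [|M] cP; first by exists (fun=> 0).
suff: forall m, (m <= M)%N -> exists q, forall i, (i <= m)%N -> forall x,
    knot x0 H i <= x <= knot x0 H i.+1 -> q x = (P i).[x].
  by move=> /(_ M (leqnn M)).
elim=> [_|m IH mM].
  by exists (horner (P 0%N)) => i; rewrite leqn0 => /eqP ->.
have [q qP] := IH (ltnW mM).
exists (fun x => if x < knot x0 H m.+1 then q x else (P m.+1).[x]) => i im x xi.
move: im; rewrite leq_eqVlt ltnS => /predU1P[iE|im].
  by rewrite {}iE in xi *; case/andP: xi => mx _; rewrite ltNge mx.
have [_|mx] := ltP; first exact: qP.
(* Among the old elements only element [m] reaches the knot [m.+1], and only in that point, where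
   the two pieces agree. *)
have [iE|im'] := eqVneq i m; last first.
  have : knot x0 H i.+1 < knot x0 H m.+1.
    by apply: knot_lt => //; rewrite ltnS ltn_neqAle im'.
  by case/andP: xi => _ xi; rewrite ltNge (le_trans mx xi).
rewrite {}iE in xi *.
have -> : x = knot x0 H m.+1 by apply/le_anti; rewrite mx andbT; case/andP: xi.
by rewrite -cP.
Qed.

(** With [1 < d] the first derivatives of the pieces match at the interior knots. This is where
    [p >= 2] is used: it places [b z'] in [QL]. *)
Lemma spline_derivative d (x0 H b : R) M f : (1 < d)%N -> 0 < H ->
  is_spline d x0 H M f ->
  exists q, is_spline d.-1 x0 H M q /\
    forall i x, (i < M)%N -> knot x0 H i < x < knot x0 H i.+1 ->
      q x = b * derive1 f x.
Proof.
move=> d1 H0 [P [fP cP]].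
have [|q qP] := @glue_pieces x0 H M (fun i => b *: (P i)^`()) H0.
  by move=> i iM; rewrite !hornerZ -!derivn1 cP.
have fP' : pieces x0 H M d f P.
  move=> i iN; have [sP {}fP] := fP _ iN; split=> // x /andP[ix xi].
  by apply: fP; rewrite !ltW.
exists q; split.
  exists (fun i => b *: (P i)^`()); split=> [i iM|i j iM jd].
    split; last exact: qP.
    rewrite (leq_trans (size_scale_leq _ _))// prednK ?(ltnW d1)//.
    have [sP _] := fP _ iM; have [->|nz] := eqVneq (P i) 0.
      by rewrite deriv0 size_poly0.
    by rewrite -ltnS (leq_trans (lt_size_deriv nz)).
  by rewrite !derivnZ !hornerZ -!derivSn cP//; move: d1 jd; case: (d).
move=> i x iM xi; rewrite (pieces_derive1 fP' iM xi) (qP i)//.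
  by rewrite hornerZ.
by case/andP: xi => *; rewrite !ltW.
Qed.

End Splines.

(** * Stability *)

Lemma L2ip_ae_weight {R : realType} (x0 x1 : R) (c w u v : R -> R) :
  measurable_fun `[x0, x1] c -> bmeas `[x0, x1] w ->
  bmeas `[x0, x1] u -> bmeas `[x0, x1] v ->
  {ae (@lebesgue_measure R), forall x, x0 <= x <= x1 -> c x = w x} ->
  L2ip x0 x1 (fun x => c x * u x) v = L2ip x0 x1 (fun x => w x * u x) v.
Proof.
move=> mc [mw _] [u_meas _] [v_meas _] cw; congr fine; apply: ae_eq_integral => //.
- by apply/measurable_EFinP; apply: measurable_funM => //; exact: measurable_funM.
- by apply/measurable_EFinP; apply: measurable_funM => //; exact: measurable_funM.
- move: cw; apply: filterS; first exact: (ae_filter_ringOfSetsType lebesgue_measure).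
  by move=> x cw; rewrite /= in_itv/= => /cw ->.
Qed.

(** Young's inequality without square roots: [4 a b <= (a + b)^2]. *)
Lemma amgm_opp {R : realType} (x a b : R) : 0 <= a -> 0 <= b ->
  x ^+ 2 <= 4 * (a * b) -> - x <= a + b.
Proof.
move=> a0 b0 xab; rewrite leNgt; apply/negP => abx.
have h1 : 0 < - x - (a + b) by lra.
have h2 : 0 < - x + (a + b) by lra.
have := mulr_gt0 h1 h2; have := sqr_ge0 (a - b); nra.
Qed.

(** For a cross term [Y = B(u, v)] with [Y^2 <= B(u, u) B(v, v)], where [g] is the scaling of the
    test direction [v]. *)
Lemma sqr_scaled_le {R : realType} (g Y e E n K : R) : 0 <= e ->
  Y ^+ 2 <= e * E -> E <= n -> g ^+ 2 * n <= K -> (g * Y) ^+ 2 <= K * e.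
Proof.
move=> e0 YE En gK; rewrite exprMn.
apply: le_trans (ler_wpM2l (sqr_ge0 g) YE) _.
rewrite mulrCA [leRHS]mulrC ler_wpM2l//; apply: le_trans gK.
by rewrite ler_wpM2l ?sqr_ge0.
Qed.

(** * Scalar inequalities behind the test function *)

Section TestFunctionArithmetic.
Context {R : realType}.
Variables (t e S F Q d alpha K y : R).
Hypotheses (t0 : 0 <= t) (e0 : 0 <= e) (Fe : t * F <= e).

(** Here [e = E(u, u)], [S = ||b u'||^2], [F = ||b (u - z)'||^2], [Q = ||q||^2], and later
    [y = t * Q]. Up to [e], the missing term [t * S] and [y] control each other. *)
Lemma sdnorm2_upper : S <= 2 * F + 2 * Q -> e + t * S <= 3 * e + 2 * (t * Q).
Proof. by move=> /(ler_wpM2l t0); rewrite mulrDr !(mulrCA t); move: Fe; lra. Qed.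

Lemma sdnorm2_lower : Q <= 2 * F + 2 * S -> t * Q <= 2 * (e + t * S).
Proof. by move=> /(ler_wpM2l t0); rewrite mulrDr !(mulrCA t); move: Fe; lra. Qed.

Hypotheses (K0 : 0 <= K) (d0 : 0 < d) (alpha0 : 0 < alpha) (y0 : 0 <= y).
Hypothesis dK : d ^+ 2 * (K + 1) = d * alpha / 4.

(** Each cross term takes a quarter of [e]; by the choice of [d] together they take
    [d * alpha / 4 * y] of the gain [d * alpha / 2 * y]. What remains, [e / 2 + d * alpha / 4 * y],
    is compared with [3 * e + 2 * y], which yields [6^-1] and [d * alpha / 8]. *)
Lemma test_lower X1 X2 P n : X1 ^+ 2 <= K * y * e -> X2 ^+ 2 <= y * e ->
  alpha / 2 * y <= P -> n <= 3 * e + 2 * y ->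
  Num.min 6^-1 (d * alpha / 8) * n <= e + (d * X1 + d * X2 + d * P).
Proof.
move=> X1e X2e /(ler_wpM2l (ltW d0)) yP ne.
have dX1 : - (d * X1) <= e / 4 + d ^+ 2 * K * y.
  apply: amgm_opp; [by rewrite divr_ge0|by rewrite mulr_ge0// mulr_ge0// sqr_ge0|].
  have -> : 4 * (e / 4 * (d ^+ 2 * K * y)) = d ^+ 2 * (K * y * e) by field.
  by rewrite exprMn ler_wpM2l ?sqr_ge0.
have dX2 : - (d * X2) <= e / 4 + d ^+ 2 * y.
  apply: amgm_opp; [by rewrite divr_ge0|by rewrite mulr_ge0// sqr_ge0|].
  have -> : 4 * (e / 4 * (d ^+ 2 * y)) = d ^+ 2 * (y * e) by field.
  by rewrite exprMn ler_wpM2l ?sqr_ge0.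
have dKy : d ^+ 2 * K * y + d ^+ 2 * y = d * alpha / 4 * y by rewrite -dK; ring.
set m := Num.min _ _.
have m6 : m <= 6^-1 by rewrite ge_min lexx.
have m8 : m <= d * alpha / 8 by rewrite ge_min lexx orbT.
have m0 : 0 <= m by rewrite le_min invr_ge0 ler0n/= divr_ge0// mulr_ge0 ?ltW.
apply: le_trans (ler_wpM2l m0 ne) _.
have := ler_wpM2r e0 m6; have := ler_wpM2r y0 m8.
rewrite mulrDr; lra.
Qed.

Lemma test_upper g nv nu : g ^+ 2 * nv <= K * y -> y <= 2 * nu ->
  2 * (d * g) ^+ 2 * nv + 2 * nu <= (2 + 4 * d ^+ 2 * K) * nu.
Proof.
move=> gK yn; have : (d * g) ^+ 2 * nv <= d ^+ 2 * K * (2 * nu).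
  have -> : (d * g) ^+ 2 * nv = d ^+ 2 * (g ^+ 2 * nv) by ring.
  have -> : d ^+ 2 * K * (2 * nu) = d ^+ 2 * (K * (2 * nu)) by ring.
  rewrite ler_wpM2l ?sqr_ge0//; apply: le_trans gK _.
  by rewrite ler_wpM2l.
lra.
Qed.

End TestFunctionArithmetic.

(** * From a test function to a bound on the supremum *)

Lemma norm_le_sqrtM {R : realType} (x G A B : R) : 0 <= G -> 0 <= A ->
  x ^+ 2 <= G * (A * B) -> `|x| <= Num.sqrt G * Num.sqrt A * Num.sqrt B.
Proof.
by move=> G0 A0 xGAB; rewrite -mulrA -sqrtr_sqr -!sqrtrM// ler_wsqrtr.
Qed.

(* [sup] is 0 on empty or unbounded sets, so a positive [sup] is a genuine one. *)
Lemma infsup_witness {R : realType} {T : Type} (A : set T) (F : T -> R) (s : R) :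
  0 < s -> s <= sup [set F v | v in A] -> exists v, A v /\ s / 2 < F v.
Proof.
move=> s0 sA; have sup_A : has_sup [set F v | v in A].
  by apply: contrapT => /sup_out A0; rewrite A0 leNgt s0 in sA.
have [_ [v Av <-] Fv] := sup_adherent (divr_gt0 s0 (ltr0n _ 2)) sup_A.
by exists v; split => //; move: sA Fv; lra.
Qed.

(** The continuity constant [M] only makes the set of quotients bounded, so that its [sup] is a true
    upper bound; it is absent from the conclusion and may depend on the mesh. *)
Lemma le_sup_of_test {R : realType} {T : Type} (V Z : T -> Prop) (a n : T -> R)
    (nu M m s : R) : 0 <= M -> 0 <= nu -> 0 < m -> 0 < s ->
  (forall v, V v -> 0 <= n v) ->
  (forall v, V v -> `|a v| <= M * Num.sqrt nu * Num.sqrt (n v)) ->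
  (forall v, V v -> ~ Z v -> n v <= 0) ->
  (exists v, [/\ V v, m * nu <= a v & n v <= s * nu]) ->
  m / Num.sqrt s * Num.sqrt nu <=
  sup [set a v / Num.sqrt (n v) | v in [set v | V v /\ Z v]].
Proof.
move=> M0 nu0 m0 s0 n0 aM nZ [v [Vv av nv]]; set A := [set v | _]; set X := [set _ | _ in _].
have Xu : has_ubound X.
  exists (M * Num.sqrt nu) => _ [w [Vw _] <-].
  have [nw0|nw0] := eqVneq (Num.sqrt (n w)) 0; first by rewrite nw0 invr0 mulr0 mulr_ge0.
  rewrite ler_pdivrMr; first exact: le_trans (ler_norm _) (aM _ Vw).
  by rewrite lt0r nw0 sqrtr_ge0.
(* If [nu = 0], the test function may fail to be admissible. Continuity then makes every quotient 0,
   and an empty set has [sup] equal to 0. *)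
move: nu0; rewrite le_eqVlt => /predU1P[nu0|nu_gt0].
  rewrite -nu0 sqrtr0 mulr0; have [[_ [w Aw _]]|X0] := pselect (X !=set0).
    apply: le_trans (ub_le_sup Xu (ex_intro2 _ _ w Aw erefl)).
    have [Vw _] := Aw; have := aM _ Vw; rewrite -nu0 sqrtr0 mulr0 mul0r normr_le0.
    by move=> /eqP ->; rewrite mul0r.
  by rewrite sup_out// => -[].
have av_gt0 : 0 < a v by apply: lt_le_trans av; rewrite mulr_gt0.
have nv_gt0 : 0 < n v.
  rewrite lt0r n0// andbT; apply: contraTneq av_gt0 => nv0.
  have := aM _ Vv; rewrite nv0 sqrtr0 mulr0 normr_le0 => /eqP ->.
  by rewrite ltxx.
have Av : A v by split=> //; apply: contrapT => /(nZ _ Vv); rewrite leNgt nv_gt0.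
apply: le_trans (ub_le_sup Xu (ex_intro2 _ _ v Av erefl)).
rewrite ler_pdivlMr ?sqrtr_gt0//; apply: le_trans av.
rewrite -!mulrA ler_pM2l// ler_pdivrMl ?sqrtr_gt0//.
rewrite -[X in _ <= _ * X](sqr_sqrtr (ltW nu_gt0)) expr2 mulrCA ler_wpM2l ?sqrtr_ge0//.
by rewrite -sqrtrM ?ler_wsqrtr// ltW.
Qed.

(** * Norm bounds and the test function on a fixed mesh *)

Section Stability.
Context {R : realType}.
Variables (x0 x1 b eps tau sigma0 K0 C : R) (p N L : nat) (w : R -> R).
Variables (Pi : nat -> (R -> R) -> (R -> R)) (CPi : nat -> R).
Local Notation h := (msize x0 x1 N).
Local Notation I := `[x0, x1]%classic.
Local Notation t := (tau * ck R L).
Hypotheses (x01 : x0 < x1) (p2 : (2 <= p)%N) (N0 : (0 < N)%N).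
Hypotheses (NL : (2 ^ L %| N)%N) (eps0 : 0 < eps) (tau0 : 0 <= tau).
Hypotheses (sigma_gt0 : 0 < sigma0) (bw : bmeas I w) (C0 : 0 <= C).
Hypothesis wE : forall x, x0 <= x <= x1 -> sigma0 <= w x <= K0.
Hypothesis invC : forall (a h : R) (P : {poly R}), 0 < h -> (size P <= p.+1)%N ->
  L2ip a (a + h) (horner P^`()) (horner P^`()) <=
  C / h ^+ 2 * L2ip a (a + h) (horner P) (horner P).
Hypothesis qi : forall k, (1 <= k <= L)%N -> quasi_interp p x0 x1 N k (CPi k) (Pi k).

(** The weight [w] replaces [c]: it has its bounds everywhere, not just almost everywhere. *)
Definition energy (u v : R -> R) : R :=
  eps * L2ip x0 x1 (derive1 u) (derive1 v) + L2ip x0 x1 (fun x => w x * u x) v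
  + s_MQ x0 x1 b tau L Pi u v.

Definition sdnorm2 (v : R -> R) : R := energy v v +
  t * L2ip x0 x1 (fun x => b * derive1 v x) (fun x => b * derive1 v x).

Let h_gt0 : 0 < h.
Proof. by rewrite divr_gt0 ?subr_gt0// ltr0n. Qed.

Let x1E : knot x0 h N = x1.
Proof. by rewrite /knot /msize mulrC divfK ?pnatr_eq0 -?lt0n// addrC subrK. Qed.

Let t_ge0 : 0 <= t.
Proof. by rewrite mulr_ge0// invr_ge0 exprn_ge0. Qed.

Let K0_ge0 : 0 <= K0.
Proof.
have /andP[s k] : sigma0 <= w x0 <= K0 by apply: wE; rewrite lexx ltW.
by apply: ltW; apply: lt_le_trans sigma_gt0 (le_trans s k).
Qed.

Lemma Vh_pp v : Vh p x0 x1 N v -> pp x0 h N p v.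
Proof.
move=> [sv _]; apply: (@spline_pp _ x0 h N h_gt0 p 0); first exact: dvd1n.
by rewrite expr0 mul1r expn0 divn1.
Qed.

Lemma Vh_lin_closed : lin_closed (Vh p x0 x1 N).
Proof.
move=> a f g [sf [f0 f1]] [sg [g0 g1]]; split; first exact: spline_lin_closed.
by rewrite f0 f1 g0 g1 !mulr0 !addr0.
Qed.

Let ppb v : pp x0 h N p v -> bmeas I v.
Proof. exact: pp_bmeas. Qed.

Lemma Vh_bmeas v : Vh p x0 x1 N v -> bmeas I v.
Proof. by move=> /Vh_pp/ppb. Qed.

Let ppdb v : pp x0 h N p v -> bmeas I (fun x => b * derive1 v x).
Proof. by move=> /pp_derive1/ppb/bmeasZ. Qed.

Let qi_pp k f : (1 <= k <= L)%N -> pp x0 h N p (Pi k f).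
Proof.
move=> kL; have [_ [/(_ f) sf _]] := qi kL.
apply: (spline_pp h_gt0 _ sf); apply: dvdn_trans NL; apply: dvdn_exp2l.
by case/andP: kL.
Qed.

Lemma stab_psd k : (1 <= k <= L)%N ->
  psd (Vh p x0 x1 N) (fun u v =>
    L2ip x0 x1 (fun x => b * derive1 (fun y => u y - Pi k u y) x)
               (fun x => b * derive1 (fun y => v y - Pi k v y) x)).
Proof.
move=> kL; apply: (psd_comp (T := fun u y => u y - Pi k u y) (L2ip_derive1_psd h_gt0 x1E p b)).
  by move=> f /Vh_pp pf; apply: pp_sub => //; exact: qi_pp.
move=> a f g; have [-> _] := qi kL.
by apply/funext => x; ring.
Qed.

Lemma s_MQ_psd : psd (Vh p x0 x1 N) (s_MQ x0 x1 b tau L Pi).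
Proof.
have sk k : k \in index_iota 1 L.+1 -> psd (Vh p x0 x1 N) (fun u v => ck R k *
    L2ip x0 x1 (fun x => b * derive1 (fun y => u y - Pi k u y) x)
               (fun x => b * derive1 (fun y => v y - Pi k v y) x)).
  rewrite mem_index_iota ltnS => kL.
  by apply: (psdZ _ (stab_psd kL)); rewrite invr_ge0 exprn_ge0.
exact: (psdZ tau0 (psd_sum sk)).
Qed.

Let bderive_psd : psd (Vh p x0 x1 N) (fun f g =>
  L2ip x0 x1 (fun x => b * derive1 f x) (fun x => b * derive1 g x)).
Proof. exact: (psdS Vh_pp (L2ip_derive1_psd h_gt0 x1E p b)). Qed.

Lemma weight_psd : psd (Vh p x0 x1 N) (fun u v => L2ip x0 x1 (fun x => w x * u x) v).
Proof.
apply: (psdS Vh_bmeas); apply: L2ip_psd => // x /=; rewrite in_itv/= => /wE/andP[+ _].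
by apply: le_trans; exact: ltW.
Qed.

Lemma energy_psd : psd (Vh p x0 x1 N) energy.
Proof.
have := psdS Vh_pp (L2ip_derive1_psd h_gt0 x1E p 1).
have -> : (fun f g : R -> R => L2ip x0 x1 (fun x => 1 * derive1 f x) (fun x => 1 * derive1 g x))
    = (fun f g => L2ip x0 x1 (derive1 f) (derive1 g)).
  apply/funext => f; apply/funext => g.
  by apply: eq_Rintegral => x _; rewrite !mul1r.
by move=> der_psd; exact: (psdD (psdD (psdZ (ltW eps0) der_psd) weight_psd) s_MQ_psd).
Qed.

Lemma sdnorm2_psd : psd (Vh p x0 x1 N) (fun u v => energy u v +
  t * L2ip x0 x1 (fun x => b * derive1 u x) (fun x => b * derive1 v x)).
Proof. exact: (psdD energy_psd (psdZ t_ge0 bderive_psd)). Qed.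

Let inv_derive v : pp x0 h N p v ->
  L2ip x0 x1 (derive1 v) (derive1 v) <= C / h ^+ 2 * L2ip x0 x1 v v.
Proof. by move=> pv; apply: (ler_derive1_L2ip h_gt0 x1E pv). Qed.

Let inv_bderive v : pp x0 h N p v ->
  L2ip x0 x1 (fun x => b * derive1 v x) (fun x => b * derive1 v x) <=
  b ^+ 2 * (C / h ^+ 2 * L2ip x0 x1 v v).
Proof.
move=> pv; have bv' := ppb (pp_derive1 pv).
by rewrite L2ipZZ// ler_wpM2l ?sqr_ge0// inv_derive.
Qed.

(** The difference [v - Pi k v] is a piecewise polynomial on the fine mesh, so the inverse estimate
    applies to it with the fine [h]; L2 stability of [Pi k] does the rest. *)
Lemma quasi_interp_inverse k v : (1 <= k <= L)%N -> Vh p x0 x1 N v ->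
  L2ip x0 x1 (fun x => b * derive1 (fun y => v y - Pi k v y) x)
             (fun x => b * derive1 (fun y => v y - Pi k v y) x) <=
  b ^+ 2 * (C / h ^+ 2 * (2 * (1 + CPi k ^+ 2) * L2ip x0 x1 v v)).
Proof.
move=> kL Vv; have pv := Vh_pp Vv; have pPv := qi_pp v kL.
apply: le_trans (inv_bderive (pp_sub pv pPv)) _.
rewrite ler_wpM2l ?sqr_ge0// ler_wpM2l ?divr_ge0 ?sqr_ge0//.
have := psd_le (@bmeas_lin_closed _ I) (L2ip_psd1 x0 x1) (-1) (ppb pPv) (ppb pv).
have -> : (fun x => -1 * Pi k v x + v x) = (fun x => v x - Pi k v x).
  by apply/funext => x; ring.
move/le_trans; apply.
have : L2ip x0 x1 (Pi k v) (Pi k v) <= CPi k ^+ 2 * L2ip x0 x1 v v.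
  have [_ [_ [_ [/(_ v (bmeas_inL2 (ppb pv))) st _]]]] := qi kL.
  rewrite -!sqr_L2norm -exprMn ler_pXn2r// nnegrE ?sqrtr_ge0//.
  exact: le_trans (sqrtr_ge0 _) st.
lra.
Qed.

(** One summand per term of [sdnorm2]. It blows up as [h] tends to 0; only its product with [t] is
    uniform. *)
Definition sdnorm2_const : R := eps * (C / h ^+ 2) + K0 +
  tau * (\sum_(1 <= k < L.+1) ck R k * (b ^+ 2 * (C / h ^+ 2 * (2 * (1 + CPi k ^+ 2)))))
  + t * (b ^+ 2 * (C / h ^+ 2)).

Lemma sdnorm2_le v : Vh p x0 x1 N v -> sdnorm2 v <= sdnorm2_const * L2ip x0 x1 v v.
Proof.
move=> Vv; have pv := Vh_pp Vv; rewrite /sdnorm2_const !mulrDl.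
apply: lerD; [apply: lerD; [apply: lerD|]|].
- by rewrite -mulrA ler_wpM2l ?inv_derive// ltW.
- apply: ler_L2ip_weight => //; first exact: Vh_bmeas.
  by move=> x /=; rewrite in_itv/= => /wE/andP[].
- rewrite -mulrA ler_wpM2l// mulr_suml; apply: ler_sum_nat => k; rewrite ltnS => kL.
  rewrite -mulrA ler_wpM2l ?invr_ge0 ?exprn_ge0//.
  apply: le_trans (quasi_interp_inverse kL Vv) _.
  by rewrite le_eqVlt; apply/orP; left; apply/eqP; ring.
- rewrite -[leRHS]mulrA ler_wpM2l//; apply: le_trans (inv_bderive pv) _.
  by rewrite !mulrA.
Qed.

Lemma energy_le_sdnorm2 v : Vh p x0 x1 N v -> energy v v <= sdnorm2 v.
Proof.
move=> Vv; rewrite lerDl mulr_ge0//; have [_ _ +] := bderive_psd; exact.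
Qed.

Lemma L2ip_le_sdnorm2 v : Vh p x0 x1 N v -> sigma0 * L2ip x0 x1 v v <= sdnorm2 v.
Proof.
move=> Vv; apply: le_trans (energy_le_sdnorm2 Vv).
have s0 : 0 <= s_MQ x0 x1 b tau L Pi v v by have [_ _ +] := s_MQ_psd; exact.
have d0 : 0 <= eps * L2ip x0 x1 (derive1 v) (derive1 v).
  by rewrite mulr_ge0 ?(ltW eps0)// -sqr_L2norm sqr_ge0.
have : sigma0 * L2ip x0 x1 v v <= L2ip x0 x1 (fun x => w x * v x) v.
  apply: ger_L2ip_weight => //; first exact: Vh_bmeas.
  by move=> x /=; rewrite in_itv/= => /wE/andP[].
rewrite /energy; lra.
Qed.

Definition a_w u v := energy u v + L2ip x0 x1 (fun x => b * derive1 u x) v.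

Lemma sdnorm2_ge0 v : Vh p x0 x1 N v -> 0 <= sdnorm2 v.
Proof. by move=> Vv; have [_ _ +] := sdnorm2_psd; exact. Qed.

Variables (Ctau alpha : R).
Hypotheses (Ctau_gt0 : 0 < Ctau) (alpha_gt0 : 0 < alpha).
Hypothesis tau_eps : t * eps <= Ctau * h ^+ 2.
Hypothesis tau_b : t * (h * `|b|) <= Ctau * h ^+ 2.
Hypothesis infsup : forall q, QL p x0 x1 N L q ->
  sup [set L2ip x0 x1 v q / L2norm x0 x1 v
      | v in [set v | Vh p x0 x1 N v /\ nonzero_on x0 x1 v]]
    >= alpha * L2norm x0 x1 q.

(** The summands match those of [sdnorm2_const] after multiplication by [t]. The factor [2 ^+ L]
    arises because the stabilization carries [tau = 2 ^+ L * t]. *)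
Definition stab_const : R := Ctau * C + Ctau * (x1 - x0) / `|b| * K0 +
  2 ^+ L * Ctau ^+ 2 * C * (\sum_(1 <= k < L.+1) 2 * (1 + CPi k ^+ 2)) + Ctau ^+ 2 * C.

Lemma sumCPi_ge0 : 0 <= \sum_(1 <= k < L.+1) 2 * (1 + CPi k ^+ 2).
Proof. by apply: sumr_ge0 => k _; rewrite mulr_ge0// addr_ge0// sqr_ge0. Qed.

Lemma stab_const_ge0 : 0 <= stab_const.
Proof.
have Ct0 := ltW Ctau_gt0.
have d0 : 0 <= x1 - x0 by rewrite subr_ge0 ltW.
by rewrite !addr_ge0// ?mulr_ge0 ?sumCPi_ge0 ?sqr_ge0 ?exprn_ge0 ?invr_ge0.
Qed.

Lemma sdnorm2_const_le : b != 0 -> t * sdnorm2_const <= stab_const.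
Proof.
move=> b0; have nb0 : 0 < `|b| by rewrite normr_gt0.
have hn0 : h != 0 by rewrite gt_eqF.
(* All terms but diffusion are governed by [r <= Ctau]: the streamline and stabilization terms
   through [r ^+ 2], the reaction term through [t = r * h / |b|] and [h <= x1 - x0]. *)
pose r := t * `|b| / h.
have r0 : 0 <= r by rewrite mulr_ge0 ?invr_ge0 ?(ltW h_gt0)// mulr_ge0.
have rC : r <= Ctau.
  rewrite ler_pdivrMr// -(ler_pM2r h_gt0).
  have -> : t * `|b| * h = t * (h * `|b|) by ring.
  by have -> : Ctau * h * h = Ctau * h ^+ 2 by ring.
have r2C : r ^+ 2 <= Ctau ^+ 2 by rewrite ler_pXn2r// nnegrE ltW.
have b2E : b ^+ 2 = `|b| ^+ 2 by rewrite real_normK// num_real.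
have tauE : tau = 2 ^+ L * t by rewrite mulrCA divff ?mulr1// gt_eqF// exprn_gt0.
rewrite /sdnorm2_const !mulrDr; apply: lerD; [apply: lerD; [apply: lerD|]|].
- have -> : t * (eps * (C / h ^+ 2)) = (t * eps / h ^+ 2) * C by field.
  by rewrite ler_wpM2r// ler_pdivrMr// exprn_gt0.
- rewrite ler_wpM2r//; have -> : t = r * h / `|b| by rewrite /r; field; rewrite hn0 gt_eqF.
  rewrite ler_wpM2r ?invr_ge0// ler_pM// ?(ltW h_gt0)//.
  by rewrite /msize ler_pdivrMr ?ltr0n// ler_peMr ?ler1n// subr_ge0 ltW.
- apply: (@le_trans _ _ (t * (tau * (b ^+ 2 * (C / h ^+ 2) *
    \sum_(1 <= k < L.+1) 2 * (1 + CPi k ^+ 2))))).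
    rewrite ler_wpM2l// ler_wpM2l// mulr_sumr; apply: ler_sum => k _.
    have -> : b ^+ 2 * (C / h ^+ 2) * (2 * (1 + CPi k ^+ 2)) =
      1 * (b ^+ 2 * (C / h ^+ 2 * (2 * (1 + CPi k ^+ 2)))) by ring.
    rewrite ler_wpM2r//.
      have G0 : 0 <= 2 * (1 + CPi k ^+ 2) by rewrite mulr_ge0// addr_ge0// sqr_ge0.
      by rewrite mulr_ge0 ?sqr_ge0// mulr_ge0// divr_ge0 ?sqr_ge0.
    by rewrite invf_le1 ?exprn_gt0// exprn_ege1// ler1n.
  rewrite [X in t * (X * _)]tauE b2E.
  have -> S : t * (2 ^+ L * t * (`|b| ^+ 2 * (C / h ^+ 2) * S)) =
    2 ^+ L * r ^+ 2 * C * S by rewrite /r; field.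
  by rewrite ler_wpM2r ?sumCPi_ge0// ler_wpM2r// ler_wpM2l ?exprn_ge0.
- rewrite b2E; have -> : t * (t * (`|b| ^+ 2 * (C / h ^+ 2))) = r ^+ 2 * C.
    by rewrite /r; field.
  by rewrite ler_wpM2r.
Qed.

Lemma coarse_projection u : Vh p x0 x1 N u -> exists z,
  [/\ is_spline p x0 (2 ^+ L * h) (N %/ 2 ^ L) z, pp x0 h N p z
    & t * L2ip x0 x1 (fun x => b * derive1 (fun y => u y - z y) x)
                     (fun x => b * derive1 (fun y => u y - z y) x) <= energy u u].
Proof.
move=> Vu; have [E1 [E2 E3]] : [/\ 0 <= s_MQ x0 x1 b tau L Pi u u,
    0 <= eps * L2ip x0 x1 (derive1 u) (derive1 u) &
    0 <= L2ip x0 x1 (fun x => w x * u x) u].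
  split; [by have [_ _ +] := s_MQ_psd; exact| |by have [_ _ +] := weight_psd; exact].
  by rewrite mulr_ge0 ?(ltW eps0)// -sqr_L2norm sqr_ge0.
have [L0|L0] := posnP L.
  exists u; split; [|exact: Vh_pp|].
    by have [+ _] := Vu; rewrite L0 expr0 mul1r expn0 divn1.
  have -> : (fun y => u y - u y) = cst 0 by apply/funext => y; rewrite subrr.
  rewrite (_ : L2ip _ _ _ _ = 0) ?mulr0 ?addr_ge0//.
  rewrite /L2ip -[RHS](mul0r (fine (lebesgue_measure I))) -Rintegral_cst//.
  by apply: eq_Rintegral => x _; rewrite derive1_cst mulr0 mul0r.
have LL : (1 <= L <= L)%N by rewrite L0 leqnn.
exists (Pi L u); split; [by have [_ [/(_ u) + _]] := qi LL|exact: qi_pp|].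
apply: (@le_trans _ _ (s_MQ x0 x1 b tau L Pi u u)); last by rewrite lerDr addr_ge0.
rewrite /s_MQ -mulrA ler_wpM2l// big_nat_recr//= lerDr big_nat.
apply: sumr_ge0 => k /andP[k1 kL]; rewrite mulr_ge0 ?invr_ge0 ?exprn_ge0//.
have kL' : (1 <= k <= L)%N by rewrite k1 ltnW.
by have [_ _ +] := stab_psd kL'; exact.
Qed.

Lemma advection_skew u : Vh p x0 x1 N u -> L2ip x0 x1 (fun x => b * derive1 u x) u = 0.
Proof.
move=> Vu; have pu := Vh_pp Vu; have [su [u0 u1]] := Vu.
transitivity (b * L2ip x0 x1 (derive1 u) u).
  rewrite /L2ip -RintegralZl//.
    by apply: eq_Rintegral => x _; rewrite mulrA.
  exact/bmeas_integrable/(bmeasM (ppb (pp_derive1 pu)) (ppb pu)).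
by rewrite (spline_integration_by_parts h_gt0 x1E su) u0 u1 subrr mul0r mulr0.
Qed.

(** Solves [d ^+ 2 * (K + 1) = d * alpha / 4]; the 1 added to [K] pays for the cross term with
    [b (u - z)']. *)
Definition test_weight : R := alpha / (4 * (stab_const + 1)).

Lemma test_function u : Vh p x0 x1 N u -> exists v,
  [/\ Vh p x0 x1 N v,
      Num.min 6^-1 (test_weight * alpha / 8) * sdnorm2 u <= a_w u v
    & sdnorm2 v <= (2 + 4 * test_weight ^+ 2 * stab_const) * sdnorm2 u].
Proof.
move=> Vu; have pu := Vh_pp Vu.
have K_ge0 := stab_const_ge0; set K := stab_const in K_ge0 *.
have d_gt0 : 0 < test_weight.
  by rewrite divr_gt0// mulr_gt0// ltr_wpDl.
have dK : test_weight ^+ 2 * (K + 1) = test_weight * alpha / 4.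
  by rewrite /test_weight -/K; field; rewrite gt_eqF// ltr_wpDl.
set d := test_weight in d_gt0 dK *.
have [z [sz pz D2e]] := coarse_projection Vu.
have [q [sq qE]] := spline_derivative b p2 (mulr_gt0 (exprn_gt0 L (ltr0n _ 2)) h_gt0) sz.
have bq : bmeas I q by exact: (pp_bmeas h_gt0 x1E (spline_pp h_gt0 NL sq)).
set F := fun x => b * derive1 (fun y => u y - z y) x in D2e.
pose B x := b * derive1 u x.
have bF : bmeas I F by apply: ppdb; exact: pp_sub.
have bB : bmeas I B by exact: ppdb.
have FE i x : (i < N)%N -> knot x0 h i < x < knot x0 h i.+1 -> F x = B x - q x.
  move=> iN xi; rewrite /F /B.
  have -> : (fun y => u y - z y) = (fun y => -1 * z y + u y).
    by apply/funext => y; ring.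
  rewrite (derive1_lin (-1) pz pu iN xi).
  have [jN ji ij] := coarse_elt x0 h_gt0 NL iN.
  rewrite (qE _ _ jN); first by ring.
  by case/andP: xi => ix xi; rewrite (le_lt_trans ji ix) (lt_le_trans xi ij).
have eqB : eq_elts x0 h N B (fun x => 1 * F x + q x).
  by move=> i x iN xi; rewrite (FE i)//; ring.
have eqq : eq_elts x0 h N q (fun x => -1 * F x + B x).
  by move=> i x iN xi; rewrite (FE i)//; ring.
have cl := @bmeas_lin_closed _ I; have ps := L2ip_psd1 x0 x1.
have SE : L2ip x0 x1 B B <= 2 * L2ip x0 x1 F F + 2 * L2ip x0 x1 q q.
  have bFq := cl 1 F q bF bq.
  rewrite (eq_elts_L2ip h_gt0 x1E bB bFq bB bFq eqB eqB).
  by have := psd_le cl ps 1 bF bq; rewrite expr1n mulr1.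
have QE : L2ip x0 x1 q q <= 2 * L2ip x0 x1 F F + 2 * L2ip x0 x1 B B.
  have bFB := cl (-1) F B bF bB.
  rewrite (eq_elts_L2ip h_gt0 x1E bq bFB bq bFB eqq eqq).
  by have := psd_le cl ps (-1) bF bB; rewrite sqrrN expr1n mulr1.
have e_ge0 : 0 <= energy u u by have [_ _ +] := energy_psd; exact.
have nE : sdnorm2 u = energy u u + t * L2ip x0 x1 B B by [].
set y := t * L2ip x0 x1 q q.
(* The scaled direction [g v] plays the role of [t w]. If [q] vanishes, [g = 0] suffices; otherwise
   [b] is nonzero, as the uniform bound on [t * sdnorm2_const] requires. *)
have [g [v [Vv gq gn gv]]] : exists g v, [/\ Vh p x0 x1 N v,
    alpha / 2 * y <= g * L2ip x0 x1 q v, g ^+ 2 * sdnorm2 v <= K * y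
    & g ^+ 2 * L2ip x0 x1 v v <= t * y].
  have [Q0|Q_gt0] := leP (L2norm x0 x1 q) 0.
    have y0 : y = 0.
      by rewrite /y -sqr_L2norm (@le_anti _ _ (L2norm x0 x1 q) 0) ?expr0n ?mulr0// Q0 sqrtr_ge0.
    by exists 0, u; rewrite y0 expr0n !mulr0 !mul0r.
  have b_neq0 : b != 0.
    apply: contraTneq Q_gt0 => b0; rewrite -leNgt /L2norm.
    rewrite (_ : L2ip _ _ _ _ = 0) ?sqrtr0//.
    have b0' : bmeas I (cst 0 : R -> R) by exact: bmeas_cst.
    have q0 : eq_elts x0 h N q (cst 0).
      by move=> i x iN xi; rewrite (eqq i)// /F /B b0 !mul0r mulr0 addr0.
    rewrite (eq_elts_L2ip h_gt0 x1E bq b0' bq b0' q0 q0).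
    rewrite /L2ip -[RHS](mul0r (fine (lebesgue_measure I))) -Rintegral_cst//.
    by apply: eq_Rintegral => x _; rewrite mulr0.
  have [v [[Vv _] vq]] := infsup_witness (mulr_gt0 alpha_gt0 Q_gt0) (infsup sq).
  set Q := L2norm x0 x1 q in Q_gt0 vq.
  have v_gt0 : 0 < L2norm x0 x1 v.
    rewrite lt0r sqrtr_ge0 andbT; apply: contraTneq vq => ->.
    by rewrite invr0 mulr0 -leNgt divr_ge0// mulr_ge0 ?ltW.
  set nu := L2norm x0 x1 v in v_gt0 vq.
  have yE : y = t * Q ^+ 2 by rewrite sqr_L2norm.
  (* The inf-sup witness is not normalized; this factor gives [g v] the L2 norm [t * Q]. The half in
     [alpha / 2] is lost because the supremum is only approached. *)
  exists (t * Q / nu), v; split=> //.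
  - have -> : L2ip x0 x1 q v = L2ip x0 x1 v q.
      by apply: eq_Rintegral => x _; rewrite mulrC.
    have -> : t * Q / nu * L2ip x0 x1 v q = t * Q * (L2ip x0 x1 v q / nu) by ring.
    have -> : alpha / 2 * y = t * Q * (alpha * Q / 2) by rewrite yE; field.
    by rewrite ler_wpM2l ?(ltW vq)// mulr_ge0// ltW.
  - have -> : (t * Q / nu) ^+ 2 * sdnorm2 v = (t * Q ^+ 2 / nu ^+ 2) * (t * sdnorm2 v).
      by field; rewrite gt_eqF.
    rewrite yE; have -> : K * (t * Q ^+ 2) = (t * Q ^+ 2 / nu ^+ 2) * (K * nu ^+ 2).
      by field; rewrite gt_eqF.
    apply: ler_wpM2l; first by rewrite divr_ge0 ?sqr_ge0// mulr_ge0// sqr_ge0.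
    apply: le_trans (ler_wpM2l t_ge0 (sdnorm2_le Vv)) _.
    by rewrite mulrA -sqr_L2norm ler_wpM2r ?sqr_ge0// sdnorm2_const_le.
  - rewrite -sqr_L2norm -/nu yE le_eqVlt; apply/orP; left; apply/eqP.
    by field; rewrite gt_eqF.
have y_ge0 : 0 <= y by rewrite mulr_ge0// -sqr_L2norm sqr_ge0.
have bv := Vh_bmeas Vv.
pose X1 := g * energy u v; pose X2 := g * L2ip x0 x1 F v.
have X1_le : X1 ^+ 2 <= K * y * energy u u :=
  sqr_scaled_le e_ge0 (psd_CS Vh_lin_closed energy_psd Vu Vv) (energy_le_sdnorm2 Vv) gn.
have X2_le : X2 ^+ 2 <= y * energy u u.
  have F0 : 0 <= L2ip x0 x1 F F by rewrite -sqr_L2norm sqr_ge0.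
  apply: le_trans (sqr_scaled_le F0 (psd_CS cl ps bF bv) (lexx _) gv) _.
  by rewrite [t * y]mulrC -mulrA ler_wpM2l.
have BvE : L2ip x0 x1 B v = L2ip x0 x1 F v + L2ip x0 x1 q v.
  rewrite (eq_elts_L2ip h_gt0 x1E bB (cl 1 F q bF bq) bv bv eqB)//.
  by have [-> // _ _] := ps; rewrite mul1r.
have aE : a_w u (fun x => d * g * v x + u x) =
    energy u u + (d * X1 + d * X2 + d * (g * L2ip x0 x1 q v)).
  have skew : L2ip x0 x1 B u = 0 by exact: advection_skew.
  rewrite /a_w (psd_linr Vh_lin_closed energy_psd _ Vv Vu Vu).
  rewrite (psd_linr cl ps _ bv (Vh_bmeas Vu) bB) skew BvE /X1 /X2.
  move: (energy u v) (energy u u) (L2ip x0 x1 F v) (L2ip x0 x1 q v) => *; ring.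
exists (fun x => d * g * v x + u x); split; first exact: Vh_lin_closed.
  rewrite aE; apply: (test_lower e_ge0 K_ge0 d_gt0 alpha_gt0 y_ge0 dK X1_le X2_le gq).
  exact: (sdnorm2_upper t_ge0 D2e SE).
have := psd_le Vh_lin_closed sdnorm2_psd (d * g) Vv Vu; move/le_trans; apply.
exact: (test_upper d K_ge0 gn (sdnorm2_lower t_ge0 D2e QE)).
Qed.

(** Cauchy-Schwarz handles the symmetric part. The advection part uses the inverse estimate on [u],
    hence a constant depending on [h], and one factor [sigma0^-1] for each argument. *)
Lemma a_w_continuous : exists2 M, 0 <= M & forall u v,
  Vh p x0 x1 N u -> Vh p x0 x1 N v ->
  `|a_w u v| <= M * Num.sqrt (sdnorm2 u) * Num.sqrt (sdnorm2 v).
Proof.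
pose G := b ^+ 2 * (C / h ^+ 2) / sigma0 / sigma0.
have s0 := ltW sigma_gt0.
have G0 : 0 <= G by rewrite divr_ge0// divr_ge0// mulr_ge0 ?sqr_ge0// divr_ge0 ?sqr_ge0.
exists (1 + Num.sqrt G) => [|u v Vu Vv]; first by rewrite addr_ge0.
have nu0 := sdnorm2_ge0 Vu; have nv0 := sdnorm2_ge0 Vv.
have E0 f : Vh p x0 x1 N f -> 0 <= energy f f by have [_ _ +] := energy_psd; exact.
have E_le : `|energy u v| <= Num.sqrt 1 * Num.sqrt (sdnorm2 u) * Num.sqrt (sdnorm2 v).
  apply: (norm_le_sqrtM ler01 nu0).
  apply: le_trans (psd_CS Vh_lin_closed energy_psd Vu Vv) _.
  rewrite mul1r.
  exact: (ler_pM (E0 _ Vu) (E0 _ Vv) (energy_le_sdnorm2 Vu) (energy_le_sdnorm2 Vv)).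
have bu := ppdb (Vh_pp Vu); have cl := @bmeas_lin_closed _ I.
have L2le f : Vh p x0 x1 N f -> L2ip x0 x1 f f <= sdnorm2 f / sigma0.
  by move=> Vf; rewrite (ler_pdivlMr _ _ sigma_gt0) [leLHS]mulrC; exact: L2ip_le_sdnorm2.
have B_le : L2ip x0 x1 (fun x => b * derive1 u x) (fun x => b * derive1 u x) <=
    b ^+ 2 * (C / h ^+ 2 * (sdnorm2 u / sigma0)).
  apply: le_trans (inv_bderive (Vh_pp Vu)) _.
  have Ch : 0 <= C / h ^+ 2 by rewrite divr_ge0 ?sqr_ge0.
  exact: (ler_wpM2l (sqr_ge0 b) (ler_wpM2l Ch (L2le _ Vu))).
have L2_ge0 f : 0 <= L2ip x0 x1 f f by rewrite -sqr_L2norm sqr_ge0.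
have B_bd : `|L2ip x0 x1 (fun x => b * derive1 u x) v| <=
    Num.sqrt G * Num.sqrt (sdnorm2 u) * Num.sqrt (sdnorm2 v).
  apply: (norm_le_sqrtM G0 nu0).
  apply: le_trans (psd_CS cl (L2ip_psd1 x0 x1) bu (Vh_bmeas Vv)) _.
  apply: le_trans (ler_pM (L2_ge0 _) (L2_ge0 _) B_le (L2le _ Vv)) _.
  rewrite /G; move: (sdnorm2 u) (sdnorm2 v) => nu nv.
  by rewrite le_eqVlt; apply/orP; left; apply/eqP; ring.
apply: le_trans (ler_normD _ _) _; apply: le_trans (lerD E_le B_bd) _.
by rewrite sqrtr1 !mulrDl.
Qed.

Definition infsup_const : R := Num.min 6^-1 (test_weight * alpha / 8) /
  Num.sqrt (2 + 4 * test_weight ^+ 2 * stab_const).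

Lemma test_weight_gt0 : 0 < test_weight.
Proof. by rewrite divr_gt0// mulr_gt0// ltr_wpDl// stab_const_ge0. Qed.

Lemma infsup_denom_gt0 : 0 < 2 + 4 * test_weight ^+ 2 * stab_const.
Proof. by rewrite ltr_wpDr// mulr_ge0 ?stab_const_ge0// mulr_ge0// sqr_ge0. Qed.

Lemma infsup_const_gt0 : 0 < infsup_const.
Proof.
rewrite divr_gt0 ?sqrtr_gt0 ?infsup_denom_gt0// lt_min invr_gt0 ltr0n/=.
by rewrite divr_gt0// mulr_gt0// test_weight_gt0.
Qed.

Lemma infsup_a_w u : Vh p x0 x1 N u ->
  infsup_const * Num.sqrt (sdnorm2 u) <=
  sup [set a_w u v / Num.sqrt (sdnorm2 v)
      | v in [set v | Vh p x0 x1 N v /\ nonzero_on x0 x1 v]].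
Proof.
move=> Vu; have [M M0 aM] := a_w_continuous.
have m_gt0 : 0 < Num.min 6^-1 (test_weight * alpha / 8).
  by rewrite lt_min invr_gt0 ltr0n/= divr_gt0// mulr_gt0// test_weight_gt0.
apply: (le_sup_of_test M0 (sdnorm2_ge0 Vu) m_gt0 infsup_denom_gt0 sdnorm2_ge0
  (fun v => aM u v Vu) _ (test_function Vu)) => v Vv vz.
(* A [v] vanishing on the interval gets norm 0 from [sdnorm2_le], without looking at [derive1] at
   the end points. *)
have v0 x : x0 <= x <= x1 -> v x = 0.
  by move=> xI; apply/eqP/negPn/negP => vx; apply: vz; exists x.
have L2v : L2ip x0 x1 v v = 0.
  rewrite /L2ip -[RHS](mul0r (fine (lebesgue_measure I))) -Rintegral_cst//.
  by apply: eq_Rintegral => x /set_mem/=; rewrite in_itv/= => /v0 ->; rewrite mul0r.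
by have := sdnorm2_le Vv; rewrite L2v mulr0.
Qed.

End Stability.

(** * Passage from the given coefficient to the clamped weight *)

Theorem mainTheorem6 (R : realType) (x0 x1 : R) (p L : nat) (b : R)
    (c : R -> R) (sigma0 Cc Ctau alpha : R) (CPi : nat -> R) :
  x0 < x1 -> (2 <= p)%N ->
  measurable_fun `[x0, x1] c ->
  0 < sigma0 ->
  {ae (@lebesgue_measure R), forall x, x0 <= x <= x1 -> sigma0 <= c x <= Cc} ->
  0 < Ctau -> 0 < alpha -> (forall k, (1 <= k <= L)%N -> 0 < CPi k) ->
  exists beta : R, 0 < beta /\
  forall (N : nat) (eps tau : R) (Pi : nat -> (R -> R) -> (R -> R)),
    (0 < N)%N -> (2 ^ L %| N)%N -> 0 < eps ->
    let h := msize x0 x1 N in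
    0 <= tau -> tau <= Ctau * (ck R L)^-1 * h ^+ 2 / Num.max eps (h * `|b|) ->
    (forall k, (1 <= k <= L)%N -> quasi_interp p x0 x1 N k (CPi k) (Pi k)) ->
    (forall q, QL p x0 x1 N L q ->
       sup [set L2ip x0 x1 v q / L2norm x0 x1 v
           | v in [set v | Vh p x0 x1 N v /\ nonzero_on x0 x1 v]]
         >= alpha * L2norm x0 x1 q) ->
    forall u, Vh p x0 x1 N u ->
      sup [set a_MQ x0 x1 eps b c tau L Pi u v / normMQSD x0 x1 eps b c tau L Pi v
          | v in [set v | Vh p x0 x1 N v /\ nonzero_on x0 x1 v]]
        >= beta * normMQSD x0 x1 eps b c tau L Pi u.
Proof.
move=> x01 p2 mc s0 cb Ct0 al0 CPi0.
have [C C0 invC] := @inverse_estimate R p.+1.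
pose K0 := Num.max sigma0 Cc.
(* Clamping c gives a weight bounded everywhere that agrees with c a.e. *)
pose w x := Num.max sigma0 (Num.min (c x) Cc).
have wE x : x0 <= x <= x1 -> sigma0 <= w x <= K0.
  move=> _; apply/andP; split; first by rewrite /w le_max lexx.
  by rewrite /w /K0 ge_max !le_max !ge_min !lexx !orbT.
have bw : bmeas `[x0, x1] w.
  split.
    apply: measurable_maxr; first exact: measurable_cst.
    by apply: measurable_minr => //; exact: measurable_cst.
  exists K0 => x /=; rewrite in_itv/= => /wE/andP[sw wK].
  by rewrite ger0_norm// (le_trans (ltW s0)).
have cw : {ae (@lebesgue_measure R), forall x, x0 <= x <= x1 -> c x = w x}.
  move: cb; apply: filterS; first exact: (ae_filter_ringOfSetsType lebesgue_measure).
  move=> x cx xI; have /andP[sc cC] := cx xI.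
  by rewrite /w min_l// max_r.
(* All arguments are fixed before the mesh, [eps], [tau] and the projectors are introduced, which is
   the claimed uniformity. *)
exists (infsup_const x0 x1 b K0 C L CPi Ctau alpha); split.
  exact: (infsup_const_gt0 b L CPi x01 s0 C0 wE Ct0 al0).
move=> N eps tau Pi N0 NL eps0 h tau0 tau_le qi infsup u Vu.
have h0 : 0 < h by rewrite divr_gt0 ?subr_gt0// ltr0n.
(* Used with [m = eps] and [m = h |b|], the two halves of the maximum. *)
have tauP m : 0 <= m -> m <= Num.max eps (h * `|b|) ->
    tau * ck R L * m <= Ctau * h ^+ 2.
  move=> m0 m_le; have max0 : 0 < Num.max eps (h * `|b|) by rewrite lt_max eps0.
  have ck0 : 0 < ck R L by rewrite invr_gt0 exprn_gt0.
  have tck : 0 <= tau * ck R L by rewrite mulr_ge0// ltW.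
  apply: le_trans (ler_wpM2l tck m_le) _.
  move: tau_le; rewrite ler_pdivlMr// => /(ler_wpM2l (ltW ck0)).
  have -> : ck R L * (Ctau / ck R L * h ^+ 2) = Ctau * h ^+ 2.
    by field; rewrite gt_eqF.
  by rewrite mulrA [ck R L * _]mulrC.
have weightE f g : Vh p x0 x1 N f -> Vh p x0 x1 N g ->
    L2ip x0 x1 (fun x => c x * f x) g = L2ip x0 x1 (fun x => w x * f x) g.
  move=> Vf Vg.
  exact: (L2ip_ae_weight mc bw (Vh_bmeas x01 N0 Vf) (Vh_bmeas x01 N0 Vg) cw).
have normE v : Vh p x0 x1 N v -> normMQSD x0 x1 eps b c tau L Pi v =
    Num.sqrt (sdnorm2 x0 x1 b eps tau L w Pi v).
  by move=> Vv; rewrite /normMQSD /normG2 weightE.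
have aE v : Vh p x0 x1 N v -> a_MQ x0 x1 eps b c tau L Pi u v =
    a_w x0 x1 b eps tau L w Pi u v.
  move=> Vv; rewrite /a_MQ /a_form weightE// /a_w /energy.
  by rewrite -!addrA; congr (_ + _); rewrite addrC -addrA.
have tau_eps : tau * ck R L * eps <= Ctau * h ^+ 2.
  by apply: tauP; [exact: ltW | rewrite le_max lexx].
have tau_b : tau * ck R L * (h * `|b|) <= Ctau * h ^+ 2.
  by apply: tauP; [rewrite mulr_ge0// ltW | rewrite le_max lexx orbT].
rewrite normE//.
have -> : [set a_MQ x0 x1 eps b c tau L Pi u v / normMQSD x0 x1 eps b c tau L Pi v
    | v in [set v | Vh p x0 x1 N v /\ nonzero_on x0 x1 v]] =
  [set a_w x0 x1 b eps tau L w Pi u v / Num.sqrt (sdnorm2 x0 x1 b eps tau L w Pi v)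
    | v in [set v | Vh p x0 x1 N v /\ nonzero_on x0 x1 v]].
  by apply: eq_imagel => v [Vv _]; rewrite aE// normE.
exact: (infsup_a_w x01 p2 N0 NL eps0 tau0 s0 bw C0 wE invC qi Ct0 al0 tau_eps tau_b infsup Vu).
Qed.
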